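(* For every number of processes $n$ and every abstract object $(Q,q_0,O,R,\Delta)$ with $R\cap O=\emptyset$ and $\bot\notin R\cup O$, Algorithm U (given in the context), with each of its R-LLSC objects implemented by Algorithm L (given in the context) from a single atomic CAS object, is a linearizable, wait-free, state-quiescent history-independent implementation of that abstract object; that is, it is a linearizable wait-free state-quiescent HI universal implementation.
   Context: **Model.** An abstract object is a tuple $(Q,q_0,O,R,\Delta)$: states, initial state, operations, responses, and a deterministic sequential specification $\Delta:Q\times O\to Q\times R$; all states are reachable from $q_0$. Asynchronous processes $p_1,\dots,p_n$ communicate through shared base objects. An implementation gives each process a program for each operation; after an invocation the process takes steps, each consisting of local computation and one atomic primitive operation on a base object, and may eventually return a response. Each process has at most one pending high-level operation at a time. A configuration gives the local state of each process and the state of each base object; the initial configuration is unique. An execution is an alternating sequence of configurations and steps from the initial configuration. For a finite execution $\alpha$, $\mathrm{mem}(\alpha)$ is the vector of base-object states (not local states) in its last configuration. $H(\alpha)$ is the sequence of invocations and responses of high-level operations in $\alpha$. **Linearizability.** A completion of $H(\alpha)$ appends responses to zero or more pending operations. A linearization of $\alpha$ is a sequential history that is a permutation of a completion of $H(\alpha)$ (pending operations without responses being dropped), matches the sequential specification, and respects the real-time order of non-overlapping operations. An implementation is linearizable if every execution has a linearization; a linearization function $h$ maps each execution $\alpha$ to a linearization $h(\alpha)$. For a sequential history $H$, $\mathrm{state}(H)$ is the state reached by applying its operations in order from $q_0$. **State-quiescent HI.** An operation is state-changing if it moves the object from some state $q$ to some $q'\ne q$, and read-only otherwise. A configuration is state-quiescent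 if no state-changing operation is pending in it. An implementation is state-quiescent HI if for some linearization function $h$, for all finite executions $\alpha,\alpha'$ ending in state-quiescent configurations with $\mathrm{state}(h(\alpha))=\mathrm{state}(h(\alpha'))$ we have $\mathrm{mem}(\alpha)=\mathrm{mem}(\alpha')$. **Wait-freedom.** Every pending operation by a process returns within a finite number of steps of that process. **CAS object.** An atomic object $X$ holding a value, supporting $\mathrm{Read}(X)$, $\mathrm{Write}(X,v)$ and $\mathrm{CAS}(X,old,new)$, which, if the value is $old$, sets it to $new$ and returns true, and otherwise leaves it unchanged and returns false. **R-LLSC object** over domain $V$: the state is a pair $(val,context)$ with $val\in V$ and $context$ a set of processes, initially $(v_0,\emptyset)$. Operations by $p_i$: LL adds $p_i$ to $context$ and returns $val$; VL returns whether $p_i\in context$; SC$(v)$: if $p_i\in context$, sets $val=v$, $context=\emptyset$ and returns true, else returns false; RL removes $p_i$ from $context$ and returns true; Load returns $val$; Store$(v)$ sets $val=v$, $context=\emptyset$ and returns true. **Algorithm L** (R-LLSC from one CAS object $X$ with values $(v,c_1,\dots,c_n)\in V\times\{0,1\}^n$, initially $(v_0,0,\dots,0)$), code for $p_i$: - LL: repeat: $cur\leftarrow\mathrm{Read}(X)$, $new\leftarrow cur$ with $c_i$ set to $1$; until $\mathrm{CAS}(X,cur,new)$ returns true; return the $v$-component of $cur$. - SC$(v)$: loop: $cur\leftarrow\mathrm{Read}(X)$; if $c_i=0$ in $cur$, return false; if $\mathrm{CAS}(X,cur,(v,0,\dots,0))$ returns true, return true. - RL: loop: $cur\leftarrow\mathrm{Read}(X)$;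 if $c_i=0$ in $cur$, return true; $new\leftarrow cur$ with $c_i$ set to $0$; if $\mathrm{CAS}(X,cur,new)$ returns true, return true. - VL: $cur\leftarrow\mathrm{Read}(X)$; return whether $c_i=1$ in $cur$. - Load: $cur\leftarrow\mathrm{Read}(X)$; return the $v$-component. - Store$(v)$: $\mathrm{Write}(X,(v,0,\dots,0))$; return true. **Algorithm U**, code for $p_i$. Shared R-LLSC objects: $head$, initially $\langle q_0,\bot\rangle$ (values in $Q\times(\{\bot\}\cup R\times\{1,\dots,n\})$), and $announce[1..n]$, each initially $\bot$ (values in $O\cup R\cup\{\bot\}$). Each process has a persistent local variable $priority_i\in\{1,\dots,n\}$, initially $i$. The notation ''$S\ \|\ T$'' means the process interleaves steps of $S$ and of $T$, with some unspecified finite number of steps on each side before switching to the other; if $S$ completes first the process continues with the next line; if the wait condition at the start of $T$ becomes satisfied first, $S$ is abandoned and the rest of $T$ is executed. ''$\_$'' denotes an arbitrary value. Read-only operation $op$: $\langle q,\_\rangle\leftarrow\mathrm{Load}(head)$; let $(\_,rsp)=\Delta(q,op)$; return $rsp$. State-changing operation $op$: (1) $\mathrm{Store}(announce[i],op)$. (2) If $\mathrm{Load}(announce[i])\in R$, go to (12). (3) $\langle q,r\rangle\leftarrow\mathrm{LL}(head)$ $\ \|\ $ [wait until $\mathrm{Load}(announce[i])\in R$; go to (12)]. (4) If $r\ne\bot$, go to (8). (5) $help\leftarrow\mathrm{Load}(announce[priority_i])$. If $help\in O$, set $aop\leftarrow help$, $j\leftarrow priority_i$. Otherwise, if $\mathrm{Load}(announce[i])\notin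 O$ go to (2); else set $aop\leftarrow op$, $j\leftarrow i$. (6) $(state,rsp)\leftarrow\Delta(q,aop)$. (7) If $\mathrm{SC}(head,\langle state,\langle rsp,j\rangle\rangle)$ returns true, advance $priority_i$ cyclically by one in $\{1,\dots,n\}$. Go to (2). (8) $\langle rsp,j\rangle\leftarrow r$. (9) $a\leftarrow\mathrm{LL}(announce[j])$ $\ \|\ $ [wait until $\mathrm{Load}(announce[i])\in R$; $\mathrm{RL}(announce[j])$; go to (12)]. (10) If $\mathrm{VL}(head)$ returns true: if $a\in O$ then $\mathrm{SC}(announce[j],rsp)$; then (in either case) $\mathrm{SC}(head,\langle q,\bot\rangle)$. (11) If $a=\bot$ then $\mathrm{RL}(announce[j])$. Go to (2). (12) $response\leftarrow\mathrm{Load}(announce[i])$. (13) $\langle q,r\rangle\leftarrow\mathrm{LL}(head)$ $\ \|\ $ [wait until $\mathrm{Load}(head)$ is not of the form $\langle\_,\langle\_,i\rangle\rangle$; go to (15)]. (14) If $r=\langle\_,i\rangle$ then $\mathrm{SC}(head,\langle q,\bot\rangle)$ and go to (16). (15) $\mathrm{RL}(head)$. (16) $\mathrm{Store}(announce[i],\bot)$. (17) Return $response$. *)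

(* Defs.v *)
From mathcomp Require Import all_boot boolp.

Set Implicit Arguments.
Unset Strict Implicit.
Unset Printing Implicit Defensive.

(** * Abstract objects *)

Record object := Object {
  state : Type;
  q0 : state;
  operation : Type;
  response : Type;
  delta : state -> operation -> state * response;
  reachable : forall q, exists s : seq operation,
    foldl (fun q o => (delta q o).1) q0 s = q
}.

Definition state_changing (A : object) (o : operation A) : Prop :=
  exists q, (delta q o).1 <> q.

(** * Base objects *)

Record base_object := BaseObject {
  bstate : Type;
  binit : bstate;
  prim : Type;
  prim_res : prim -> Type;
  apply_prim : bstate -> forall p : prim, bstate * prim_res p
}.

Inductive cas_prim (V : Type) := Read | Write (v : V) | CAS (old new : V).
Arguments Read {V}.

Definition cas_res (V : Type) (p : cas_prim V) : Type :=
  match p with Read => V | Write _ => unit | CAS _ _ => bool end.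

Definition cas_apply (V : Type) (x : V) (p : cas_prim V) : V * cas_res p :=
  match p return V * cas_res p with
  | Read => (x, x)
  | Write v => (v, tt)
  | CAS old new => if `[< x = old >] then (new, true) else (x, false)
  end.

Definition cas_object (V : Type) (v0 : V) : base_object :=
  BaseObject v0 (@cas_apply V).

(** * Implementations and their executions *)

(** What a process with a pending operation does next: either one primitive on
    a base object, after which its new local state depends on the result and
    on a free choice, or return a response while keeping its persistent local
    variables. *)
Inductive local_step (base : Type) (obj : base -> base_object)
    (resp persistent frame choice : Type) :=
| Prim (b : base) (p : prim (obj b)) (k : prim_res p -> choice -> frame)
| Return (r : resp) (x : persistent).
Arguments Prim {base obj resp persistent frame choice} b p k.
Arguments Return {base obj resp persistent frame choice} r x.

(** [frame] is the local state of a process during an operation and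
    [persistent] what it keeps between operations.  The elements of [choice]
    resolve whatever the code leaves unspecified; every resolution gives rise
    to an execution. *)
Record implementation (n : nat) (A : object) := Implementation {
  base : eqType;
  obj : base -> base_object;
  persistent : Type;
  pinit : 'I_n -> persistent;
  frame : Type;
  choice : Type;
  choice_inhabited : inhabited choice;
  start : 'I_n -> operation A -> persistent -> choice -> frame;
  next : frame -> local_step obj (response A) persistent frame choice
}.

Section Executions.
Variables (n : nat) (A : object) (I : implementation n A).

Inductive proc_state :=
| Idle (x : persistent I)
| Busy (o : operation A) (f : frame I).

Record config := Config {
  mem : forall b : base I, bstate (obj b);
  proc : 'I_n -> proc_state
}.

Definition init_config : config :=
  Config (fun b => binit (obj b)) (fun i => Idle (pinit I i)).

Inductive event := Inv (i : 'I_n) (o : operation A)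
                 | Res (i : 'I_n) (r : response A).

Inductive label := Event (e : event) | Internal (i : 'I_n).

Definition actor (l : label) : 'I_n :=
  match l with Event (Inv i _) | Event (Res i _) | Internal i => i end.

Definition set_proc (c : config) (i : 'I_n) (s : proc_state) :
  'I_n -> proc_state := fun j => if j == i then s else proc c j.

Definition advance (c : config) (i : 'I_n) (o : operation A)
    (a : local_step (@obj _ _ I) (response A) (persistent I) (frame I) (choice I))
    (w : choice I) : label * config :=
  match a with
  | Prim b p k =>
      let sr := apply_prim (mem c b) p in
      (Internal i, Config (dfwith (mem c) sr.1)
                          (set_proc c i (Busy o (k sr.2 w))))
  | Return r x => (Event (Res i r), Config (mem c) (set_proc c i (Idle x)))
  end.

Inductive step (c : config) : label * config -> Prop :=
| StepInv i o x w : proc c i = Idle x ->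
    step c (Event (Inv i o),
            Config (mem c) (set_proc c i (Busy o (start i o x w))))
| StepBusy i o f w : proc c i = Busy o f ->
    step c (advance c i o (next f) w).

(** Finite and infinite executions alike: the [t]-th item is the [t]-th step
    together with the configuration it leads to, and [None] means that the
    execution has at most [t] steps.  A finite execution is given by a sequence
    [a], read as the trace [onth a]. *)
Definition trace := nat -> option (label * config).

Definition config_at (tr : trace) (t : nat) : option config :=
  if t is t'.+1 then omap snd (tr t') else Some init_config.

Definition execution (tr : trace) : Prop :=
  forall t x, tr t = Some x -> exists2 c, config_at tr t = Some c & step c x.

Definition final (a : seq (label * config)) : config :=
  last init_config (map snd a).

(** Events are dated by the index of their step; only their order matters. *)
Definition history_of (tr : trace) (t : nat) : option event :=
  if tr t is Some (Event e, _) then Some e else None.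

(** * Linearizability *)

(** An operation of a sequential history: process, operation, response. *)
Definition seq_op : Type := 'I_n * operation A * response A.

Fixpoint state_after (S : nat -> option seq_op) (k : nat) : state A :=
  if k is k'.+1 then
    if S k' is Some (_, o, _) then (delta (state_after S k') o).1
    else state_after S k'
  else q0 A.

Definition state_of (S : seq seq_op) : state A := state_after (onth S) (size S).

Section Linearization.
Variable H : nat -> option event.

Definition returns (s t : nat) (x : seq_op) : Prop :=
  let: (i, o, r) := x in
  [/\ s < t, H s = Some (Inv i o), H t = Some (Res i r)
    & forall u r', s < u < t -> H u <> Some (Res i r')].

Definition pending (s : nat) (i : 'I_n) (o : operation A) : Prop :=
  H s = Some (Inv i o) /\ forall t r, s < t -> H t <> Some (Res i r).

(** [compl s] is the response, if any, that the completion appends to the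
    pending operation invoked at [s]; its values elsewhere are not used.  An
    operation is identified by the date of its invocation. *)
Definition completed (compl : nat -> option (response A)) (s : nat)
    (x : seq_op) : Prop :=
  (exists t, returns s t x) \/
  (let: (i, o, r) := x in pending s i o /\ compl s = Some r).

Definition precedes (s s' : nat) : Prop :=
  exists t x, returns s t x /\ t < s'.

(** [S] is a finite or infinite sequential history, and [pos k] the operation
    of the completion of [H] that it has in position [k]. *)
Definition linearization (S : nat -> option seq_op) : Prop :=
  exists (compl : nat -> option (response A)) (pos : nat -> nat),
  (forall k, S k = None -> S k.+1 = None) /\
  (forall k x, S k = Some x -> completed compl (pos k) x) /\
  (forall k k' x x', S k = Some x -> S k' = Some x' -> pos k = pos k' ->
     k = k') /\
  (forall s x, completed compl s x -> exists2 k, S k = Some x & pos k = s) /\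
  (forall k k' x x', S k = Some x -> S k' = Some x' ->
     precedes (pos k) (pos k') -> k < k') /\
  (forall k i o r, S k = Some (i, o, r) -> (delta (state_after S k) o).2 = r).

End Linearization.

Definition linearizable : Prop :=
  forall tr, execution tr -> exists S, linearization (history_of tr) S.

(** * Wait-freedom *)

Definition infinitely_often (tr : trace) (i : 'I_n) : Prop :=
  forall m, exists t x, [/\ m <= t, tr t = Some x & actor x.1 = i].

Definition wait_free : Prop :=
  forall tr t c i o f, execution tr ->
    config_at tr t = Some c -> proc c i = Busy o f ->
    infinitely_often tr i ->
  exists t' r c', t <= t' /\ tr t' = Some (Event (Res i r), c').

(** * State-quiescent history independence *)

Definition state_quiescent (c : config) : Prop :=
  forall i o f, proc c i = Busy o f -> ~ state_changing o.

Definition state_quiescent_HI : Prop :=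
  exists h : seq (label * config) -> seq seq_op,
  (forall a, execution (onth a) ->
     linearization (history_of (onth a)) (onth (h a))) /\
  (forall a a', execution (onth a) -> execution (onth a') ->
     state_quiescent (final a) -> state_quiescent (final a') ->
     state_of (h a) = state_of (h a') ->
   forall b, mem (final a) b = mem (final a') b).

End Executions.

(** * R-LLSC operations from a CAS object *)

Inductive llsc_op (V : Type) := LL | VL | SC (v : V) | RL | Load | Store (v : V).
Arguments LL {V}.
Arguments VL {V}.
Arguments RL {V}.
Arguments Load {V}.

Definition llsc_res (V : Type) (o : llsc_op V) : Type :=
  match o with LL | Load => V | _ => bool end.

Section AlgorithmL.
Variables (n : nat) (V : Type).

Definition cval : Type := V * {ffun 'I_n -> bool}.

Definition clear (v : V) : cval := (v, [ffun => false]).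

Definition set_bit (x : cval) (i : 'I_n) (b : bool) : cval :=
  (x.1, [ffun j => if j == i then b else x.2 j]).

(** One step of a call: the primitive applied to the CAS object and what
    follows from its result, where [inl] is the new local state of the call
    and [inr] the value that it returns. *)
Inductive llsc_step (T : Type) :=
| LStep (p : cas_prim cval) (k : cas_res p -> option cval + T).
Arguments LStep {T} p k.

(** The local state of a call is [None] when it is at the head of its loop and
    [Some cur] when it has read [cur] and is about to perform its CAS. *)
Definition algorithmL (i : 'I_n) (o : llsc_op V) (s : option cval) :
    llsc_step (llsc_res o) :=
  match o return llsc_step (llsc_res o) with
  | LL =>
      if s is Some cur then
        LStep (CAS cur (set_bit cur i true))
              (fun ok : bool => if ok then inr cur.1 else inl None)
      else LStep Read (fun cur : cval => inl (Some cur))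
  | SC v =>
      if s is Some cur then
        LStep (CAS cur (clear v))
              (fun ok : bool => if ok then inr true else inl None)
      else LStep Read
             (fun cur : cval => if cur.2 i then inl (Some cur) else inr false)
  | RL =>
      if s is Some cur then
        LStep (CAS cur (set_bit cur i false))
              (fun ok : bool => if ok then inr true else inl None)
      else LStep Read
             (fun cur : cval => if cur.2 i then inl (Some cur) else inr true)
  | VL => LStep Read (fun cur : cval => inr (cur.2 i))
  | Load => LStep Read (fun cur : cval => inr cur.1)
  | Store v => LStep (Write (clear v)) (fun=> inr true)
  end.

End AlgorithmL.

(** * The universal implementation *)

Section AlgorithmU.
Variables (n : nat) (A : object).

(** The tags make the operations, the responses and bottom disjoint. *)
Inductive cell := Bot | Op (o : operation A) | Rsp (r : response A).

Definition head_val : Type := state A * option (response A * 'I_n).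

Notation head := (@None 'I_n).
Notation announce := (@Some 'I_n).

Definition uval (b : option 'I_n) : Type :=
  if b is Some _ then cell else head_val.

Definition uinit (b : option 'I_n) : uval b :=
  if b is Some _ then Bot else (q0 A, None).

(** Control points, with the local variables live there.  Code for process
    [i]:
<<
     read-only operation op:
       0: <q,_> <- Load(head); rsp <- second component of delta(q,op);
          return rsp
     state-changing operation op:
       1: Store(announce[i],op)
       2: if Load(announce[i]) in R then goto 12
       3: <q,r> <- LL(head)
            || wait until Load(announce[i]) in R; goto 12
       4: if r <> bot then goto 8
       5: help <- Load(announce[priority])
          if help in O then aop <- help; j <- priority
          else if Load(announce[i]) notin O then goto 2
          else aop <- op; j <- i
       6: <state,rsp> <- delta(q,aop)
       7: if SC(head,<state,<rsp,j>>) then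
            advance priority cyclically
          goto 2
       8: <rsp,j> <- r
       9: a <- LL(announce[j])
            || wait until Load(announce[i]) in R; RL(announce[j]); goto 12
      10: if VL(head) then
            if a in O then SC(announce[j],rsp)
            SC(head,<q,bot>)
      11: if a = bot then RL(announce[j])
          goto 2
      12: response <- Load(announce[i])
      13: <q,r> <- LL(head)
            || wait until Load(head) is not <_,<_,i>>; goto 15
      14: if r = <_,i> then SC(head,<q,bot>); goto 16
      15: RL(head)
      16: Store(announce[i],bot)
      17: return response
>>
    Lines 4, 6 and 8 and the tests in 11 and 14 are local and belong to the
    step that precedes them. *)
Inductive line :=
| U0 (op : operation A)
| U1 (op : operation A)
| U2 (op : operation A)
| U3 (op : operation A)
| U5_help (op : operation A) (q : state A)
| U5_own (op : operation A) (q : state A)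
| U7 (op : operation A) (sr : state A * response A) (j : 'I_n)
| U9 (op : operation A) (q : state A) (rsp : response A) (j : 'I_n)
| U9_RL (j : 'I_n)
| U10_VL (op : operation A) (q : state A) (rsp : response A) (j : 'I_n) (a : cell)
| U10_ann (op : operation A) (q : state A) (rsp : response A) (j : 'I_n) (a : cell)
| U10_head (op : operation A) (q : state A) (j : 'I_n) (a : cell)
| U11 (op : operation A) (j : 'I_n)
| U12
| U13 (rsp : response A)
| U14 (rsp : response A) (q : state A)
| U15 (rsp : response A)
| U16 (rsp : response A)
| U17 (rsp : response A).

(** [Call b o k] calls [o] on the R-LLSC object [b]; [k] gives the new value of
    [priority] and the next line.  [Par b k b' wait] is
    [LL(b) || wait until Load(b') satisfies ...]: it goes to [k v] when the LL
    returns [v], and to [l] when a Load returns some [v] with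
    [wait v = Some l]. *)
Inductive instr :=
| Call (b : option 'I_n) (o : llsc_op (uval b)) (k : llsc_res o -> 'I_n * line)
| Par (b : option 'I_n) (k : uval b -> line)
      (b' : option 'I_n) (wait : uval b' -> option line)
| Ret (rsp : response A).
Arguments Call b o k : clear implicits.
Arguments Par b k b' wait : clear implicits.

Definition is_for (i : 'I_n) (r : option (response A * 'I_n)) : bool :=
  if r is Some (_, j) then j == i else false.

Definition after10 (op : operation A) (j : 'I_n) (a : cell) : line :=
  if a is Bot then U11 op j else U2 op.

Definition code (i priority : 'I_n) (l : line) : instr :=
  let goto l := (priority, l) in
  match l with
  | U0 op =>
      Call head Load
        (fun x : head_val => goto (U17 (delta x.1 op).2))
  | U1 op =>
      Call (announce i) (Store (Op op))
        (fun=> goto (U2 op))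
  | U2 op =>
      Call (announce i) Load
        (fun a : cell => goto (if a is Rsp _ then U12 else U3 op))
  | U3 op =>
      Par head
        (fun x : head_val =>
           if x.2 is Some (rsp, j) then U9 op x.1 rsp j else U5_help op x.1)
        (announce i)
        (fun a : cell => if a is Rsp _ then Some U12 else None)
  | U5_help op q =>
      Call (announce priority) Load
        (fun help : cell =>
           goto (if help is Op aop then U7 op (delta q aop) priority
                 else U5_own op q))
  | U5_own op q =>
      Call (announce i) Load
        (fun a : cell =>
           goto (if a is Op _ then U7 op (delta q op) i else U2 op))
  | U7 op sr j =>
      Call head (SC (sr.1, Some (sr.2, j)))
        (fun ok : bool => (if ok then ordS priority else priority, U2 op))
  | U9 op q rsp j =>
      Par (announce j) (fun a : cell => U10_VL op q rsp j a)
        (announce i)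
        (fun a : cell => if a is Rsp _ then Some (U9_RL j) else None)
  | U9_RL j =>
      Call (announce j) RL (fun=> goto U12)
  | U10_VL op q rsp j a =>
      Call head VL
        (fun ok : bool =>
           goto (if ok then
                   if a is Op _ then U10_ann op q rsp j a
                   else U10_head op q j a
                 else after10 op j a))
  | U10_ann op q rsp j a =>
      Call (announce j) (SC (Rsp rsp))
        (fun=> goto (U10_head op q j a))
  | U10_head op q j a =>
      Call head (SC (q, None))
        (fun=> goto (after10 op j a))
  | U11 op j =>
      Call (announce j) RL (fun=> goto (U2 op))
  | U12 =>
      (* Without a response there is nothing to return: the process would
         repeat this line, and wait-freedom implies that it does not. *)
      Call (announce i) Load
        (fun a : cell => goto (if a is Rsp rsp then U13 rsp else U12))
  | U13 rsp =>
      Par head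
        (fun x : head_val => if is_for i x.2 then U14 rsp x.1 else U15 rsp)
        head
        (fun x : head_val => if is_for i x.2 then None else Some (U15 rsp))
  | U14 rsp q =>
      Call head (SC (q, None))
        (fun=> goto (U16 rsp))
  | U15 rsp =>
      Call head RL (fun=> goto (U16 rsp))
  | U16 rsp =>
      Call (announce i) (Store Bot)
        (fun=> goto (U17 rsp))
  | U17 rsp => Ret rsp
  end.

(** A turn [(true, m)] (resp. [(false, m)]) in an instruction [S || T] means
    that the next [m + 1] steps are those of [S] (resp. [T]).  Both the side
    that starts and the length of each turn are free choices. *)
Definition turn : Type := bool * nat.

Definition next_turn (u w : turn) : turn :=
  if u.2 is m.+1 then (u.1, m) else (~~ u.1, w.2).

(** Progress of process [i] within an instruction. *)
Definition substate (c : instr) : Type :=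
  match c with
  | Call b _ _ => option (cval n (uval b))
  | Par b _ _ _ => option (cval n (uval b)) * turn
  | Ret _ => unit
  end.

Definition fresh (c : instr) (w : turn) : substate c :=
  match c return substate c with
  | Call _ _ _ => None
  | Par _ _ _ _ => (None, w)
  | Ret _ => tt
  end.

Record uframe := UFrame {
  me : 'I_n;
  priority : 'I_n;
  at_line : line;
  progress : substate (code me priority at_line)
}.

Definition enter (i : 'I_n) (pl : 'I_n * line) (w : turn) : uframe :=
  UFrame (fresh (code i pl.1 pl.2) w).

Definition uobj (b : option 'I_n) : base_object := cas_object (clear n (uinit b)).

Definition ustep := local_step uobj (response A) 'I_n uframe turn.

(** A Load is the single primitive Read, so each step of the waiting side of a
    [Par] is one complete Load. *)
Definition run_instr (i pr : 'I_n) (c : instr) (stay : substate c -> uframe) :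
    substate c -> ustep :=
  match c return (substate c -> uframe) -> substate c -> ustep with
  | Call b o k => fun stay s =>
      let: LStep p kp := algorithmL i o s in
      Prim (obj := uobj) b p
        (fun r w => match kp r with
                    | inl s' => stay s'
                    | inr v => enter i (k v) w
                    end)
  | Par b k b' wait => fun stay su =>
      let: (s, u) := su in
      if u.1 then
        let: LStep p kp := algorithmL i LL s in
        Prim (obj := uobj) b p
          (fun r w => match kp r with
                      | inl s' => stay (s', next_turn u w)
                      | inr v => enter i (pr, k v) w
                      end)
      else
        Prim (obj := uobj) b' Read
          (fun x w => match wait x.1 with
                      | Some l => enter i (pr, l) w
                      | None => stay (s, next_turn u w)
                      end)
  | Ret rsp => fun _ _ => Return rsp pr
  end stay.

Definition unext (f : uframe) : ustep :=
  run_instr (me f) (priority f) (UFrame (at_line := at_line f)) (progress f).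

Definition ustart (i : 'I_n) (o : operation A) (pr : 'I_n) (w : turn) : uframe :=
  enter i (pr, if `[< state_changing o >] then U1 o else U0 o) w.

Definition algorithmU : implementation n A :=
  Implementation id (inhabits ((true, 0) : turn)) ustart unext.

End AlgorithmU.

(* Main.v *)
(** Every base object acts like an atomic R-LLSC object: each primitive of
    Algorithm L either changes nothing but the local state of the call or
    carries out the whole R-LLSC operation.  Under this reading the shared memory
    has five substantial changes, each by a successful SC or a Store: an
    operation is announced, applied ([head] gets its response), answered (the
    response goes to [announce[j]]), retired from [head] and withdrawn.  The
    invariant says that they occur in this order, because a process linked to an
    object knows that its value is still the one it read.

    Linearizability: a state-changing operation is linearized when it is applied
    and a read-only one at its Load, so that the state of the linearization is
    the one in [head].  History independence: without a pending state-changing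
    operation nothing is announced, [head] holds no response and all links have
    been released.

    Wait-freedom: while the value of an object is constant, its links change
    finitely often, so that the object itself is eventually constant and the
    CAS loops on it end.  A process that retries SC or RL for ever keeps its
    link, which makes the value constant.  Hence a process with an answered
    operation returns.  Suppose that an operation of process [i] is never
    answered.  If the value of [head] is eventually constant then [i] itself ends
    up changing it.  Otherwise some process applies infinitely many
    operations; its priority reaches [i] again and again, and it applies the
    operation of [i] then, which gets answered before [head] can change. *)

From mathcomp Require Import all_boot boolp.
Require Import Defs.

Set Implicit Arguments.
Unset Strict Implicit.
Unset Printing Implicit Defensive.

(** * The steps of Algorithm U *)

Arguments LStep {n V T} p k.

Section Steps.
Variables (n : nat) (A : object).

Notation I := (algorithmU n A).
Notation head := (@None 'I_n).
Notation announce := (@Some 'I_n).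

Definition memory : Type := forall b : option 'I_n, cval n (uval A b).

Implicit Types (m : memory) (i j k : 'I_n) (f : uframe n A).

(** The R-LLSC specification, with the context of the object represented by the bits of the CAS
    value. *)
Definition atomic (V : Type) i (o : llsc_op V) (x : cval n V) :
    cval n V * llsc_res o :=
  match o return cval n V * llsc_res o with
  | LL => (set_bit x i true, x.1)
  | VL => (x, x.2 i)
  | SC v => if x.2 i then (clear n v, true) else (x, false)
  | RL => (set_bit x i false, true)
  | Load => (x, x.1)
  | Store v => (clear n v, true)
  end.

Lemma set_bit_id (V : Type) (x : cval n V) i : set_bit x i (x.2 i) = x.
Proof.
case: x => v c; congr (_, _); apply/ffunP => j; rewrite ffunE /=.
by case: eqP => [->|].
Qed.

Definition is_sc (V : Type) (o : llsc_op V) := if o is SC _ then true else false.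

(** The test preceding the CAS of SC is made when [cur] is read, so that the
    local state records it. *)
Definition tested (V : Type) i (o : llsc_op V) (s : option (cval n V)) : Prop :=
  is_sc o -> forall cur, s = Some cur -> cur.2 i.

(** A call goes on either because it has just saved the value read or because its CAS found another
    value than the saved one. SC and RL save only a value in which the caller is linked; VL, Load
    and Store never go on. *)
Definition retries (V : Type) i (o : llsc_op V) (x : cval n V)
    (s s' : option (cval n V)) : Prop :=
  match o with
  | LL => True
  | SC _ | RL => s = None -> x.2 i
  | _ => False
  end /\
  ((s = None /\ s' = Some x) \/ (exists2 cur, s = Some cur /\ cur <> x & s' = None)).

(** The primitive that ends a call is its linearization point: a successful CAS finds the very value
    that was read, and a call that gives up does so at a Read showing its link gone. For the CAS of
    SC, [tested] supplies the link that the atomic SC asks for. *)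
Lemma algorithmL_atomic (V : Type) i (o : llsc_op V) s (x : cval n V) :
  tested i o s ->
  let: LStep p kp := algorithmL i o s in
  let: (x', r) := cas_apply x p in
  match kp r with
  | inl s' => [/\ x' = x, tested i o s' & retries i o x s s']
  | inr v => (x', v) = atomic i o x
  end.
Proof.
rewrite /tested /retries; case: o => [||v|||v] //=; case: s => [cur|] //= H.
- case: asboolP => /= [->|ne] //; split=> //; split=> //; right.
  by exists cur => //; split=> // e; apply: ne.
- by split=> //; split=> //; left.
- case: asboolP => /= [e|ne]; first by rewrite e (H isT cur).
  by split=> //; split=> //; right; exists cur => //; split=> // e; apply: ne.
- case E: (x.2 i) => //; split=> //; first by move=> _ _ [<-].
  by split=> //; left.
- case: asboolP => /= [->|ne] //; split=> //; split=> //; right.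
  by exists cur => //; split=> // e; apply: ne.
- case E: (x.2 i) => /=; first by split=> //; split=> //; left.
  (* RL by an unlinked process: clearing a bit that is already clear changes nothing. *)
  by rewrite -E set_bit_id.
Qed.

Definition fires i (pr : 'I_n) (c : instr n A) m (pl : 'I_n * line n A) m' : Prop :=
  match c with
  | @Call _ _ b o k =>
      m' = dfwith m (atomic i o (m b)).1 /\ pl = k (atomic i o (m b)).2
  | @Par _ _ b k b' wait =>
      (m' = dfwith m (set_bit (m b) i true) /\ pl = (pr, k (m b).1)) \/
      (m' = m /\ exists2 l, wait (m b').1 = Some l & pl = (pr, l))
  | Ret _ => False
  end.

Definition sound i (c : instr n A) : substate c -> Prop :=
  match c return substate c -> Prop with
  | @Call _ _ b o _ => fun s => tested i o s
  | _ => fun _ => True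
  end.

Definition stays i (c : instr n A) m (w : turn) : substate c -> substate c -> Prop :=
  match c return substate c -> substate c -> Prop with
  | @Call _ _ b o _ => fun s s' => retries i o (m b) s s'
  | @Par _ _ b _ b' wait => fun su su' =>
      su'.2 = next_turn su.2 w /\
      if su.2.1 then retries i LL (m b) su.1 su'.1
      else su'.1 = su.1 /\ wait (m b').1 = None
  | Ret _ => fun _ _ => False
  end.

Lemma dfwith_id m b : dfwith m (m b) = m.
Proof.
apply: functional_extensionality_dep => b'.
by case: dfwithP.
Qed.

Lemma run_instr_cases i pr (c : instr n A) (stay : substate c -> uframe n A) s m w :
  sound i s ->
  match run_instr i pr stay s with
  | Return r x => exists2 e : c = Ret n r, x = pr & True
  | @Prim _ _ _ _ _ _ b p k =>
      let: (x, r) := cas_apply (m b) p in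
      (exists s', [/\ k r w = stay s', dfwith m x = m, sound i s' & stays i m w s s'])
      \/ (exists2 pl, k r w = enter i pl w & fires i pr c m pl (dfwith m x))
  end.
Proof.
case: c stay s => [b o k|b k b' wait|r] stay s H.
- have := @algorithmL_atomic _ i o s (m b) H.
  rewrite /=; case: (algorithmL i o s) => p kp /=; case: (cas_apply (m b) p) => x r.
  case: (kp r) => [s' [-> Hs Hr]|v].
    by left; exists s'; rewrite dfwith_id.
  by move=> <-; right; exists (k v).
- case: s H => s u H; rewrite /run_instr; case E: u.1.
    have H0 : tested i (@LL (uval A b)) s by [].
    have := algorithmL_atomic (m b) H0.
    case: (algorithmL i LL s) => p kp /=; case: (cas_apply (m b) p) => x r.
    case: (kp r) => [s' [-> Hs Hr]|v [-> ->]].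
      by left; exists (s', next_turn u w); rewrite dfwith_id E.
    by right; exists (pr, k (m b).1) => //; left.
  rewrite /=.
  case W: (wait (m b').1) => [l|].
    right; exists (pr, l) => //; right; split; last by exists l.
    by rewrite dfwith_id.
  by left; exists (s, next_turn u w); rewrite dfwith_id E.
- by exists erefl.
Qed.

Definition wf_frame i f : Prop := me f = i /\ sound (me f) (progress f).

Inductive stuck i m w : uframe n A -> uframe n A -> Prop :=
| Stuck pr l s s' : stays i m w s s' ->
    stuck i m w (@UFrame n A i pr l s) (@UFrame n A i pr l s').

Inductive busy_step (c : config I) i (o : operation A) f w :
  label n A * config I -> Prop :=
| BusyRet r : at_line f = U17 n r ->
    busy_step c i o f w
      (Event (Res i r), Config (mem c) (set_proc c i (Idle (I := I) (priority f))))
| BusyStuck f' : stuck i (mem c) w f f' -> wf_frame i f' ->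
    busy_step c i o f w
      (Internal A i, Config (mem c) (set_proc c i (Busy (I := I) o f')))
| BusyFires m' pl : fires i (priority f) (code i (priority f) (at_line f)) (mem c) pl
  m' ->
    busy_step c i o f w
      (Internal A i, Config (I := I) m' (set_proc c i (Busy (I := I) o (enter i pl
        w)))).

Lemma advance_busy (c : config I) i (o : operation A) f w : wf_frame i f ->
  busy_step c i o f w (advance (I := I) c i o (unext f) w).
Proof.
case: f => me pr l s [/= E]; subst me => Hs.
have := @run_instr_cases i pr _ (UFrame (at_line := l)) s (mem c) w Hs.
rewrite /unext /=; case: run_instr => [b p k|r x] /=.
  case E: (cas_apply (mem c b) p) => [x r] /=.
  move=> [[s' [e1 e2 e3 e4]]|[pl e1 e2]].
    by rewrite e1 e2; apply: BusyStuck.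
  by rewrite e1; apply: BusyFires.
move=> [e -> _]; apply: BusyRet => /=.
by case: l s Hs e => //= ? _ _ [->].
Qed.

End Steps.

(** * The invariant *)

Section Invariant.
Variables (n : nat) (A : object).

Notation I := (algorithmU n A).
Notation head := (@None 'I_n).
Notation announce := (@Some 'I_n).
Notation memory := (memory n A).

Implicit Types (m : memory) (i j k : 'I_n) (f : uframe n A) (a : cell A).

(** * Values and links in the shared memory *)

Definition hd m : head_val n A := (m head).1.
Definition hb m k : bool := (m head).2 k.
Definition an m j : cell A := (m (announce j)).1.
Definition ab m j k : bool := (m (announce j)).2 k.

Definition set_head m (v : head_val n A) : memory := dfwith m (i := head) (clear n (v :
  uval A head)).
Definition set_ann m j a : memory := dfwith m (i := announce j) (clear n (a : uval A
  (announce j))).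
Definition link m b i x : memory := dfwith m (i := b) (set_bit (m b) i x).

Lemma hd_set_head m v : hd (set_head m v) = v.
Proof. by rewrite /hd /set_head dfwith_in. Qed.
Lemma hb_set_head m v k : hb (set_head m v) k = false.
Proof. by rewrite /hb /set_head dfwith_in ffunE. Qed.
Lemma an_set_head m v j : an (set_head m v) j = an m j.
Proof. by rewrite /an /set_head dfwith_out. Qed.
Lemma ab_set_head m v j k : ab (set_head m v) j k = ab m j k.
Proof. by rewrite /ab /set_head dfwith_out. Qed.

Lemma hd_set_ann m j a : hd (set_ann m j a) = hd m.
Proof. by rewrite /hd /set_ann dfwith_out. Qed.
Lemma hb_set_ann m j a k : hb (set_ann m j a) k = hb m k.
Proof. by rewrite /hb /set_ann dfwith_out. Qed.
Lemma an_set_ann m j a j' : an (set_ann m j a) j' = if j' == j then a else an m j'.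
Proof.
rewrite /an /set_ann; case: eqP => [->|ne]; first by rewrite dfwith_in.
by rewrite dfwith_out //; apply/eqP => -[/esym].
Qed.
Lemma ab_set_ann m j a j' k : ab (set_ann m j a) j' k = (j' != j) && ab m j' k.
Proof.
rewrite /ab /set_ann; case: eqP => [->|ne] /=; first by rewrite dfwith_in ffunE.
by rewrite dfwith_out //; apply/eqP => -[/esym].
Qed.

Lemma val_link m b i x b' : (link m b i x b').1 = (m b').1.
Proof. by rewrite /link; case: dfwithP. Qed.
Lemma hd_link m b i x : hd (link m b i x) = hd m.
Proof. by rewrite /hd val_link. Qed.
Lemma an_link m b i x j : an (link m b i x) j = an m j.
Proof. by rewrite /an val_link. Qed.
Lemma hb_link m b i x k :
  hb (link m b i x) k = if (b == head) && (k == i) then x else hb m k.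
Proof.
rewrite /hb /link; case: eqP => [->|ne] /=; first by rewrite dfwith_in ffunE.
by rewrite dfwith_out //; apply/eqP.
Qed.
Lemma ab_link m b i x j k :
  ab (link m b i x) j k = if (b == announce j) && (k == i) then x else ab m j k.
Proof.
rewrite /ab /link; case: eqP => [->|ne] /=; first by rewrite dfwith_in ffunE.
by rewrite dfwith_out //; apply/eqP.
Qed.

Definition memE := (hd_set_head, hb_set_head, an_set_head, ab_set_head, hd_set_ann,
  hb_set_ann, an_set_ann, ab_set_ann, hd_link, an_link, hb_link, ab_link).

(** * Effects of steps and facts known at each control point *)

Definition is_rsp a : bool := if a is Rsp _ then true else false.
Definition is_op a : bool := if a is Op _ then true else false.

Definition head_for m i : bool := is_for i (hd m).2.

(** [Apply] is the SC of line 7, [Retire] that on [head] in lines 10 and 14,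
    [Respond] that on [announce[j]] in line 10, [Announce] and [Withdraw] are the
    Stores of lines 1 and 16. *)
Inductive effect k m : memory -> Prop :=
| Nothing : effect k m m
| Link b x : effect k m (link m b k x)
| Apply j o q : hd m = (q, None) -> an m j = Op o ->
    effect k m (set_head m ((delta q o).1, Some ((delta q o).2, j)))
| Retire q r j : hd m = (q, Some (r, j)) -> is_rsp (an m j) ->
    effect k m (set_head m (q, None))
| Respond q r j o : hd m = (q, Some (r, j)) -> an m j = Op o ->
    effect k m (set_ann m j (Rsp r))
| Announce o : an m k = Bot A -> ~~ head_for m k ->
    effect k m (set_ann m k (Op o))
| Withdraw : is_rsp (an m k) -> ~~ head_for m k ->
    effect k m (set_ann m k (Bot A)).

Definition active m i (o op : operation A) : Prop :=
  [/\ op = o, state_changing o & an m i = Op o \/ is_rsp (an m i)].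

(** Links to announcement objects are left to [released]: a process may still be linked to an object
    whose value has changed its owner's status, as any later SC or Store on it clears the link. *)
Definition quiet m i : Prop :=
  [/\ an m i = Bot A, ~~ head_for m i & hb m i = false].

(** The hypotheses [hb m i] and [ab m j i], that [i] is linked, carry what [i]
    knows of the object since its last LL; the value may have changed otherwise. *)
Definition line_inv m i (o : operation A) (l : line n A) : Prop :=
  match l with
  | U0 op => [/\ op = o, ~ state_changing o & quiet m i]
  | U1 op => [/\ op = o, state_changing o & quiet m i]
  | U2 op | U3 op => active m i o op
  | U5_help op q | U5_own op q =>
      active m i o op /\ (hb m i -> hd m = (q, None))
  | U7 op sr j => active m i o op /\
      (hb m i -> exists q o', [/\ hd m = (q, None), an m j = Op o' & sr = delta q o'])
  | U9 op q rsp j => active m i o op /\ (hb m i -> hd m = (q, Some (rsp, j)))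
  | U9_RL _ | U12 => state_changing o /\ is_rsp (an m i)
  | U10_VL op q rsp j a =>
      [/\ active m i o op, ab m j i -> an m j = a
        & hb m i -> [/\ hd m = (q, Some (rsp, j)), a <> Bot A
                      & ab m j i \/ is_rsp (an m j)]]
  | U10_ann op q rsp j a =>
      [/\ active m i o op, is_op a,
          ab m j i -> an m j = a /\ exists q', hd m = (q', Some (rsp, j))
        & hb m i -> hd m = (q, Some (rsp, j)) /\ (ab m j i \/ is_rsp (an m j))]
  | U10_head op q j a =>
      [/\ active m i o op, a <> Bot A
        & hb m i -> (exists r, hd m = (q, Some (r, j))) /\ is_rsp (an m j)]
  | U11 op j => active m i o op
  | U13 r => state_changing o /\ an m i = Rsp r
  | U14 r q => [/\ state_changing o, an m i = Rsp r,
      hb m i -> exists r', hd m = (q, Some (r', i)) & hb m i = false -> ~~ head_for m i]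
  | U15 r => [/\ state_changing o, an m i = Rsp r & ~~ head_for m i]
  | U16 r => [/\ state_changing o, an m i = Rsp r, ~~ head_for m i & hb m i = false]
  | U17 r => quiet m i
  end.

(** A process linked to [announce[j]] while it holds bottom still has to
    release it. *)
Definition must_release (l : option (line n A)) j : bool :=
  match l with
  | Some (U10_VL _ _ _ j' (Bot)) | Some (U11 _ j') => j' == j
  | _ => false
  end.

Definition released m i (l : option (line n A)) : Prop :=
  forall j, ab m j i -> an m j = Bot A -> must_release l j.

Lemma is_forP i (x : option (response A * 'I_n)) :
  reflect (exists r, x = Some (r, i)) (is_for i x).
Proof.
case: x => [[r j]|] /=; last by constructor => -[].
by apply: (iffP eqP) => [->|[r' [_ ->]]] //; exists r.
Qed.

(** * Steps of other processes preserve the invariant *)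

Lemma frame_quiet k m m' i : effect k m m' -> k <> i -> quiet m i -> quiet m' i.
Proof.
move=> E ne [] ; rewrite /quiet /head_for.
have nek : (i == k) = false by apply/eqP => /esym.
case: E => [|b x|j o q e1 e2|q r j e1 e2|q r j o e1 e2|o e1 e2|e1 e2] a1 a2 a3;
  rewrite ?memE ?nek ?andbF //=.
- split=> //; by apply/eqP => ej; move: a1; rewrite -ej e2.
- rewrite a1 a2 a3; case: eqP => // ej; by move: a1; rewrite ej e2.
Qed.


(** [Apply] and [Respond] need an operation in [announce[i]], and only [i] itself withdraws a
    response. So an answered operation stays answered and is not applied again. *)
Lemma frame_rsp k m m' i r : effect k m m' -> k <> i -> an m i = Rsp r ->
  an m' i = Rsp r /\ (~~ head_for m i -> ~~ head_for m' i).
Proof.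
move=> E ne; have nek : (i == k) = false by apply/eqP => /esym.
rewrite /head_for.
case: E => [|b x|j o q e1 e2|q r0 j e1 e2|q r0 j o e1 e2|o e1 e2|e1 e2] a1;
  rewrite ?memE ?nek //=.
- by split=> // _; apply/eqP => ej; move: a1; rewrite -ej e2.
- by case: eqP => // ej; move: a1; rewrite ej e2.
Qed.

Lemma frame_is_rsp k m m' i : effect k m m' -> k <> i -> is_rsp (an m i) -> is_rsp (an
  m' i).
Proof.
by move=> E ne; case a1: (an m i) => [||r] // _; case: (frame_rsp E ne a1) => ->.
Qed.

Lemma frame_active k m m' i o op :
  effect k m m' -> k <> i -> active m i o op -> active m' i o op.
Proof.
move=> E ne [e s [a|r]]; split=> //; last by right; apply: (frame_is_rsp E ne).
have nek : (i == k) = false by apply/eqP => /esym.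
case: E => [|b x|j o' q e1 e2|q r0 j e1 e2|q r0 j o' e1 e2|o' e1 e2|e1 e2];
  rewrite ?memE ?nek //=; try by left.
by case: eqP => _; [right | left].
Qed.

(** Every successful SC on [head] empties its context, so a link that has survived the step of
    another process certifies that the value is unchanged. [frame_ab] is the same for the
    announcement objects. *)
Lemma frame_hb k m m' i : effect k m m' -> k <> i -> hb m' i ->
  hb m i /\ hd m' = hd m.
Proof.
move=> E ne; have nek : (i == k) = false by apply/eqP => /esym.
by case: E => [|b x|j o q e1 e2|q r0 j e1 e2|q r0 j o e1 e2|o e1 e2|e1 e2] //=;
  rewrite ?memE ?nek ?andbF.
Qed.

Lemma frame_ab k m m' i j : effect k m m' -> k <> i -> ab m' j i ->
  ab m j i /\ an m' j = an m j.
Proof.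
move=> E ne; have nek : (i == k) = false by apply/eqP => /esym.
case: E => [|b x|j' o q e1 e2|q r0 j' e1 e2|q r0 j' o e1 e2|o e1 e2|e1 e2] //=;
  rewrite ?memE ?nek ?andbF //;
  by case: eqP => //=.
Qed.

(** While [head] holds the response for [j], process [j] can neither announce nor withdraw. The only
    change of [announce[j]] that could break the link of [i] is therefore the delivery of the
    response. *)
Lemma frame_served k m m' i q r j : effect k m m' -> k <> i ->
  hd m = (q, Some (r, j)) -> ab m j i \/ is_rsp (an m j) ->
  ab m' j i \/ is_rsp (an m' j).
Proof.
move=> E ne e; have nek : (i == k) = false by apply/eqP => /esym.
case: E => [|b x|j' o q' e1 e2|q' r0 j' e1 e2|q' r0 j' o e1 e2|o e1 e2|e1 e2] //=;
  rewrite ?memE ?nek ?andbF //;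
  case: eqP => //= ej; subst; try by right.
- by move: e2; rewrite /head_for e /= eqxx.
- by move: e2; rewrite /head_for e /= eqxx.
Qed.

(** Facts guarded by a link and speaking of the linked object carry over by [frame_hb] and
    [frame_ab]. The cases below that split on the effect are those relating one object to the value
    of another. *)
Lemma frame_line k m m' i o l :
  effect k m m' -> k <> i -> line_inv m i o l -> line_inv m' i o l.
Proof.
move=> E ne.
have Q := frame_quiet E ne.
have Ac := frame_active E ne.
have R := frame_rsp E ne.
have R' := frame_is_rsp E ne.
have B := frame_hb E ne.
have B' := frame_ab E ne.
have S := frame_served E ne.
have nek : (i == k) = false by apply/eqP => /esym.
case: l => [op|op|op|op|op q|op q|op sr j|op q rsp j|j|op q rsp j a|op q rsp j a|
  op q j a|op j||r|r q|r|r|r] /=.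
- by case=> *; split=> //; apply: Q.
- by case=> *; split=> //; apply: Q.
- exact: Ac.
- exact: Ac.
- by case=> a H; split; [exact: Ac | move=> /B [h ->]; exact: H].
- by case=> a H; split; [exact: Ac | move=> /B [h ->]; exact: H].
- case=> a H; split; [exact: Ac | move=> h']; case: (B h') => h ->.
  case: (H h) => q [o' [e1 e2 e3]]; exists q, o'; split=> //.
  (* The operation in [announce[j]] stays: answering it needs a response in [head], announcing needs
     bottom and withdrawing needs a response in its place. *)
  case: E {R R' S Q Ac B B'} h' => [|b x|j' o1 q' d1 d2|q' r0 j' d1 d2|
    q' r0 j' o1 d1 d2|o1 d1 d2|d1 d2] //=;
    rewrite ?memE //.
  + by rewrite e1 in d1.
  + by case: eqP => // ej; rewrite -ej e2 in d1.
  + by case: eqP => // ej; rewrite -ej e2 in d1.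
- by case=> a H; split; [exact: Ac | move=> /B [h ->]; exact: H].
- by case=> s r; split=> //; exact: R'.
- case=> c H1 H2; split; [exact: Ac | |]; first by move=> /B' [/H1 h ->].
  by move=> /B [/H2 [h1 h2 h3] ->]; split=> //; exact: S h1 h3.
- case=> c p H1 H2; split; [exact: Ac | by []| |].
    move=> b'; case: (B' _ b') => b ->; case: (H1 b) => e1 [q' e2]; split=> //.
    (* As [announce[j]] still holds an operation, the response for [j] cannot be retired, and no new
       operation is applied before that. *)
    case: E {R R' S Q Ac B B'} b' => [|b1 x|j' o1 q1 d1 d2|q1 r0 j' d1 d2|
      q1 r0 j' o1 d1 d2|o1 d1 d2|d1 d2] _ /=;
    rewrite ?memE; try by exists q'.
    + by rewrite e2 in d1.
    + by move: d1 d2; rewrite e2 => -[_ _ <-]; rewrite e1; case: (a) p.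
  by move=> /B [/H2 [h1 h2] ->]; split=> //; exact: S h1 h2.
- case=> c p H; split=> //; first exact: Ac.
  move=> /B [/H [[r h1] h2] h]; split; first by exists r; rewrite h.
  case: E {R R' S Q Ac B B'} h => [|b1 x|j' o1 q1 d1 d2|q1 r0 j' d1 d2|
    q1 r0 j' o1 d1 d2|o1 d1 d2|d1 d2] _ /=;
    rewrite ?memE //; case: eqP => // ej; subst.
    by rewrite d1 in h2.
  by move: d2; rewrite /head_for h1 /= eqxx.
- exact: Ac.
- by case=> s r; split=> //; exact: R'.
- by case=> s /R [].
- case=> s e H1 H2; case: (R _ e) => e' H; split=> //.
    by move=> /B [/H1 [r' h] ->]; exists r'.
  (* [head] could get a response for [i] again only if [announce[i]] held an operation, but it holds
     a response. *)
  case: E {R R' S Q Ac B B' e' H} => [|b1 x|j' o1 q1 d1 d2|q1 r0 j' d1 d2|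
    q1 r0 j' o1 d1 d2|o1 d1 d2|d1 d2] /=;
    rewrite /head_for ?memE ?nek ?andbF //.
  by move=> _ /=; apply/eqP => ej; move: e; rewrite -ej d2.
- by case=> s /R [e H] /H; split.
- case=> s /R [e H] /H h b; split=> //; apply/negP => /B [h' _]; by rewrite b in h'.
- exact: Q.
Qed.

Lemma frame_released k m m' i l : effect k m m' -> k <> i -> released m i l -> released
  m' i l.
Proof. by move=> E ne H j /(frame_ab E ne) [b ->]; apply: H. Qed.

(** * Own steps preserve the invariant *)

Inductive moves i pr m : line n A -> memory -> 'I_n * line n A -> Prop :=
| Moves0 op : moves i pr m (U0 n op) m (pr, U17 n (delta (hd m).1 op).2)
| Moves1 op : moves i pr m (U1 n op) (set_ann m i (Op op)) (pr, U2 n op)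
| Moves2 op : moves i pr m (U2 n op) m (pr, if is_rsp (an m i) then U12 n A else U3 n
  op)
| Moves3_free op q : hd m = (q, None) ->
    moves i pr m (U3 n op) (link m head i true) (pr, U5_help n op q)
| Moves3_taken op q r j : hd m = (q, Some (r, j)) ->
    moves i pr m (U3 n op) (link m head i true) (pr, U9 op q r j)
| Moves3_wait op : is_rsp (an m i) -> moves i pr m (U3 n op) m (pr, U12 n A)
| Moves5_help op q o : an m pr = Op o ->
    moves i pr m (U5_help n op q) m (pr, U7 op (delta q o) pr)
| Moves5_nobody op q : ~~ is_op (an m pr) ->
    moves i pr m (U5_help n op q) m (pr, U5_own n op q)
| Moves5_own op q : is_op (an m i) ->
    moves i pr m (U5_own n op q) m (pr, U7 op (delta q op) i)
| Moves5_served op q : ~~ is_op (an m i) -> moves i pr m (U5_own n op q) m (pr, U2 n op)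
| Moves7 op sr j : hb m i ->
    moves i pr m (U7 op sr j) (set_head m (sr.1, Some (sr.2, j))) (ordS pr, U2 n op)
| Moves7_fail op sr j : hb m i = false -> moves i pr m (U7 op sr j) m (pr, U2 n op)
| Moves9 op q r j :
    moves i pr m (U9 op q r j) (link m (announce j) i true) (pr, U10_VL op q r j (an m
      j))
| Moves9_wait op q r j : is_rsp (an m i) -> moves i pr m (U9 op q r j) m (pr, U9_RL A j)
| Moves9_RL j : moves i pr m (U9_RL A j) (link m (announce j) i false) (pr, U12 n A)
| Moves10_VL op q r j a : hb m i ->
    moves i pr m (U10_VL op q r j a) m
      (pr, if is_op a then U10_ann op q r j a else U10_head op q j a)
| Moves10_stale op q r j a : hb m i = false ->
    moves i pr m (U10_VL op q r j a) m (pr, after10 op j a)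
| Moves10_ann op q r j a : ab m j i ->
    moves i pr m (U10_ann op q r j a) (set_ann m j (Rsp r)) (pr, U10_head op q j a)
| Moves10_ann_fail op q r j a : ab m j i = false ->
    moves i pr m (U10_ann op q r j a) m (pr, U10_head op q j a)
| Moves10_head op q j a : hb m i ->
    moves i pr m (U10_head op q j a) (set_head m (q, None)) (pr, after10 op j a)
| Moves10_head_fail op q j a : hb m i = false ->
    moves i pr m (U10_head op q j a) m (pr, after10 op j a)
| Moves11 op j : moves i pr m (U11 op j) (link m (announce j) i false) (pr, U2 n op)
| Moves12 r : an m i = Rsp r -> moves i pr m (U12 n A) m (pr, U13 n r)
| Moves12_loop : ~~ is_rsp (an m i) -> moves i pr m (U12 n A) m (pr, U12 n A)
| Moves13_mine r : head_for m i ->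
    moves i pr m (U13 n r) (link m head i true) (pr, U14 n r (hd m).1)
| Moves13 r : ~~ head_for m i -> moves i pr m (U13 n r) (link m head i true) (pr, U15 n
  r)
| Moves13_wait r : ~~ head_for m i -> moves i pr m (U13 n r) m (pr, U15 n r)
| Moves14 r q : hb m i -> moves i pr m (U14 n r q) (set_head m (q, None)) (pr, U16 n r)
| Moves14_fail r q : hb m i = false -> moves i pr m (U14 n r q) m (pr, U16 n r)
| Moves15 r : moves i pr m (U15 n r) (link m head i false) (pr, U16 n r)
| Moves16 r : moves i pr m (U16 n r) (set_ann m i (Bot A)) (pr, U17 n r).

Lemma fires_moves i pr m l m' pl :
  fires i pr (code i pr l) m pl m' -> moves i pr m l m' pl.
Proof.
case: l => [op|op|op|op|op q|op q|op sr j|op q rsp j|j|op q rsp j a|op q rsp j a|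
  op q j a|op j||r|r q|r|r|r] /=.
- by case=> -> ->; rewrite dfwith_id; constructor.
- by case=> -> ->; constructor.
- case=> -> ->; rewrite dfwith_id; have := Moves2 i pr m op; rewrite /an.
  by case: (m (announce i)).1.
- case=> [[-> ->]|[-> [l' e ->]]].
    case E: (hd m) => [q [[r j]|]]; move: (E); rewrite /hd => ->; by constructor.
  move: e; case E: (m (announce i)).1 => //= -[<-]; constructor.
  by rewrite /an E.
- case=> -> ->; rewrite dfwith_id.
  case E: (m (announce pr)).1 => [|o|r] /=; constructor; by rewrite // /an E.
- case=> -> ->; rewrite dfwith_id.
  case E: (m (announce i)).1 => [|o|r] /=; constructor; by rewrite // /an E.
- case E: ((m head).2 i) => -[-> ->] /=; last by rewrite dfwith_id; constructor.
  by constructor.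
- case=> [[-> ->]|[-> [l' e ->]]]; first by constructor.
  move: e; case E: (m (announce i)).1 => //= -[<-]; constructor.
  by rewrite /an E.
- by case=> -> ->; constructor.
- case E: ((m head).2 i) => -[-> ->] /=; rewrite dfwith_id; last by constructor.
  by have := @Moves10_VL i pr m op q rsp j a E; case: (a).
- case E: ((m (announce j)).2 i) => -[-> ->] /=; last by rewrite dfwith_id; constructor.
  by constructor.
- case E: ((m head).2 i) => -[-> ->] /=; last by rewrite dfwith_id; constructor.
  by constructor.
- by case=> -> ->; constructor.
- case=> -> ->; rewrite dfwith_id.
  case E: (m (announce i)).1 => [|o|r] /=; constructor; by rewrite // /an E.
- case=> [[-> ->]|[-> [l' e ->]]].
    by case: ifP => E; constructor=> //; rewrite /head_for [is_for _ _]E.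
  by move: e; case: ifP => // E -[<-]; constructor; rewrite /head_for [is_for _ _]E.
- case E: ((m head).2 i) => -[-> ->] /=; last by rewrite dfwith_id; constructor.
  by constructor.
- by case=> -> ->; constructor.
- by case=> -> ->; constructor.
- by [].
Qed.

(** [moves] only records what the code writes. A successful SC shows that the link is set, so the
    facts guarded by it in [line_inv] hold at that moment and make the write one of the permitted
    effects. *)
Lemma moves_effect i pr m o l m' pl :
  moves i pr m l m' pl -> line_inv m i o l -> effect i m m'.
Proof.
case=> {l m' pl} /=; try by constructor.
- by move=> op [_ _ []]; constructor.
- move=> op [st r] j h [_ /(_ h)] [q [o' [e1 e2 ->]]]; exact: Apply e1 e2.
- move=> op q r j a h [_ p /(_ h) [e1 [q' e2]]] _.
  by case: a p e1 {h} => // o' _ e1; exact: Respond e2 e1.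
- by move=> op q j a h [_ _ /(_ h) [[r e1] e2]]; exact: Retire e1 e2.
- move=> r q h [_ e1 /(_ h) [r' e2] _]; apply: Retire e2 _; by rewrite e1.
- by move=> r [_ e1 e2 _]; constructor; rewrite ?e1.
Qed.

Lemma released_sub m m' i l l' : released m i l ->
  (forall j, ab m' j i -> an m' j = Bot A -> ab m j i /\ an m j = Bot A) ->
  (forall j, must_release l j -> must_release l' j) -> released m' i l'.
Proof. by move=> R s1 s2 j b e; case: (s1 j b e) => b0 e0; apply: s2; apply: R. Qed.

Lemma moves_released i pr m o l m' pl :
  moves i pr m l m' pl -> line_inv m i o l -> released m i (Some l) ->
  released m' i (Some pl.2).
Proof.
case=> {l m' pl} /=.
all: try by move=> * ;
  match goal with R : released _ _ _ |- _ => apply: (released_sub R) => k;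
  rewrite ?memE //; case: eqP end.
all: try by move=> *;
  match goal with R : released _ _ _ |- _ => apply: (released_sub R) => // end.
- move=> op q r j _ R k; rewrite ?memE eqxx andbT /=.
  case: eqP => [[<-]|ne] /=; first by move=> _ ->; rewrite eqxx.
  by move=> b e; move: (R k b e).
- move=> j _ R; apply: (released_sub R) => // k; rewrite ?memE eqxx andbT; by case: eqP.
(* A successful VL excludes that bottom was read, so no release is due on this branch. *)
- move=> op q r j a h [_ _ /(_ h) [_ ne _]] R; apply: (released_sub R) => // k /=.
  by case: (a) ne.
- move=> op q r j a h _ R; apply: (released_sub R) => // k /=; by case: (a).
- move=> op j _ R k; rewrite ?memE eqxx andbT; case: eqP => // ne b e.
  by move: (R k b e) => /= /eqP ej; case: ne; rewrite ej.
Qed.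

Lemma moves_line i pr m o l m' pl :
  (forall j, head_for m j -> an m j <> Bot A) ->
  moves i pr m l m' pl -> line_inv m i o l -> line_inv m' i o pl.2.
Proof.
move=> HB.
have ac b x op : active m i o op -> active (link m b i x) i o op.
  by rewrite /active memE.
case=> {l m' pl} /=.
- by move=> op [].
- by move=> op [-> s _]; split=> //; rewrite memE eqxx; left.
- move=> op [e s H]; case: ifP => // E; split=> //.
- move=> op q e L; split; [exact: ac|by rewrite !memE].
- move=> op q r j e L; split; [exact: ac|by rewrite !memE].
- by move=> op e [].
- move=> op q o' e [L H]; split=> // h; exists q, o'; split=> //; exact: H.
- by [].
- move=> op q e [[e1 s e2] H]; split=> // h; exists q, o; split=> //;
    last by rewrite e1.
    exact: H.
  by case: e2 e => //; case: (an m i).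
- by move=> op q e [].
- by move=> op sr j h [[e s H] _]; split=> //; rewrite memE.
- by move=> op sr j h [].
- move=> op q r j [L H]; split; first exact: ac.
    by rewrite !memE.
  rewrite !memE /= => h; move: (H h) => e; rewrite !eqxx /=; split=> //; last by left.
  by apply: HB; rewrite /head_for e /= eqxx.
- by move=> op q r j e [[]].
- by move=> j; rewrite memE.
- move=> op q r j a h [L H1 H2]; case: (H2 h) => e1 e2 e3; case: ifP => E.
    split=> // b; split; [exact: H1| by exists q].
  split=> // _; split; first by exists r.
  (* The value read is neither bottom nor an operation, so [j] is answered already. *)
  case: e3 => // b; move: (H1 b) => ->; by case: (a) e2 E.
- move=> op q r j a h [L H1 H2]; by case: (a).
- move=> op q r j a b [[e s L] H1 H2 H3].
  case: (H2 b) => e1 [q' e2]; split; first split=> //.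
  + rewrite memE; case: eqP L => [->|//] _; by right.
  + by case: (a) H1.
  + rewrite !memE eqxx => h; split=> //; exists r; by case: (H3 h).
- move=> op q r j a b [L H1 H2 H3]; split=> //; first by case: (a) H1.
  (* The SC failed because the link was lost; with [head] unchanged this means that another process
     has answered [j]. *)
  move=> h; case: (H3 h) => e; rewrite b => -[//|e2]; by split=> //; exists r.
- move=> op q j a h [[e s L] H1 H2].
  by case: (a); rewrite /= /active memE.
- by move=> op q j a h [L _ _]; case: (a).
- by move=> op j L; apply: ac.
- by move=> r e [].
- by [].
- move=> r h [s e]; rewrite /head_for !memE; split=> //; rewrite ?eqxx //= => _.
  move: h => /is_forP [r' e']; exists r'; by rewrite -e'; case: (hd m).
- by move=> r h [s e]; rewrite /head_for !memE.
- by move=> r h [].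
- by move=> r q h [s e H1 H2]; rewrite /head_for !memE.
- by move=> r q h [s e H1 H2]; rewrite H2.
- by move=> r [s e h]; rewrite /head_for !memE !eqxx.
- move=> r [s e h1 h2]; split; by rewrite /head_for !memE ?eqxx.
Qed.

End Invariant.

(** * Transitions *)

Section Transitions.
Variables (n : nat) (A : object).

Notation I := (algorithmU n A).
Notation config := (config I).
Notation Idle := (@Idle n A I).
Notation Busy := (@Busy n A I).
Notation memory := (memory n A).

Implicit Types (m : memory) (i j k : 'I_n) (f : uframe n A) (a : cell A) (c : config).

Definition proc_line (s : proc_state I) : option (line n A) :=
  if s is Defs.Busy _ f then Some (at_line f) else None.

Definition proc_inv m i (s : proc_state I) : Prop :=
  released m i (proc_line s) /\
  match s with
  | Defs.Idle _ => quiet m i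
  | Defs.Busy o f => wf_frame i f /\ line_inv m i o (at_line f)
  end.

Definition inv c : Prop := forall i, proc_inv (mem c) i (proc c i).

Definition put c i (s : proc_state I) m : config := Config (I := I) m (set_proc c i s).

Inductive transition c : label n A * config -> Prop :=
| TInv i o x w : proc c i = Idle x ->
    transition c (Event (Inv i o), put c i (Busy o (ustart i o x w)) (mem c))
| TRet i o f r : proc c i = Busy o f -> at_line f = U17 n r ->
    transition c (Event (Res i r), put c i (Idle (priority f)) (mem c))
| TStuck i o f f' w : proc c i = Busy o f -> stuck i (mem c) w f f' ->
    wf_frame i f' -> transition c (Internal A i, put c i (Busy o f') (mem c))
| TMove i o f w m' pl : proc c i = Busy o f ->
    moves i (priority f) (mem c) (at_line f) m' pl ->
    transition c (Internal A i, put c i (Busy o (enter i pl w)) m').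

Lemma step_transition c x : inv c -> step c x -> transition c x.
Proof.
move=> H; case=> [i o s w e|i o f w e]; first exact: TInv e.
have := H i; rewrite e => -[_ [wf _]].
case: (advance_busy c o w wf) => [r e'|f' st wf'|m' pl /fires_moves mv].
- exact: TRet e e'.
- exact: TStuck e st wf'.
- exact: TMove e mv.
Qed.

Lemma wf_enter i pl w : wf_frame i (enter (A := A) i pl w).
Proof.
split=> //; rewrite /enter /=.
by case: (code _ _ _).
Qed.

Lemma stuck_line i m w f f' : stuck i m w f f' ->
  [/\ me f' = i, priority f' = priority f & at_line f' = at_line f].
Proof. by case. Qed.

(** Control points of a pending operation at which its process announces nothing: a read-only
    operation, one not announced yet, or one about to return. *)
Definition calm (l : line n A) : bool :=
  match l with U0 _ | U1 _ | U17 _ => true | _ => false end.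

Lemma line_status m i o l : line_inv m i o l ->
  quiet m i /\ calm l \/ active m i o o /\ ~~ calm l.
Proof.
have ac op : active m i o op -> active m i o o by case.
have an_rsp : is_rsp (an m i) -> an m i = Op o \/ is_rsp (an m i) by right.
have an_eq r : an m i = Rsp r -> is_rsp (an m i) by move=> ->.
case: l => /=.
- by move=> op [_ _]; left.
- by move=> op [_ _]; left.
- by move=> op /ac; right.
- by move=> op /ac; right.
- by move=> op q [/ac]; right.
- by move=> op q [/ac]; right.
- by move=> op sr j [/ac]; right.
- by move=> op q r j [/ac]; right.
- by move=> _ [? /an_rsp ?]; right.
- by move=> op q r j a [/ac]; right.
- by move=> op q r j a [/ac]; right.
- by move=> op q j a [/ac]; right.
- by move=> op j /ac; right.
- by move=> [? /an_rsp ?]; right.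
- by move=> r [? /an_eq/an_rsp ?]; right.
- by move=> r q [? /an_eq/an_rsp ?]; right.
- by move=> r [? /an_eq/an_rsp ?]; right.
- by move=> r [? /an_eq/an_rsp ?]; right.
- by left.
Qed.

(** A process whose announcement is bottom is idle or at a calm line, hence quiet, and [head] holds
    nothing for a quiet process. This is the hypothesis of [moves_line]. *)
Lemma head_for_unanswered c : inv c ->
  forall j, head_for (mem c) j -> an (mem c) j <> Bot A.
Proof.
move=> H j h e.
suff [_ /negP] : quiet (mem c) j by [].
case: (H j) => _; case: (proc c j) => [//|o f [_ /line_status [[]//|[[_ _ a] _]]]].
by move: a; rewrite e => -[].
Qed.

Lemma transition_effect c x : inv c -> transition c x ->
  effect (actor x.1) (mem c) (mem x.2).
Proof.
move=> H; case=> [i o s w e|i o f r e _|i o f f' w e _ _|i o f w m' pl e M] /=;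
  try exact: Nothing.
by move: (H i); rewrite e => -[_ [_ L]]; exact: moves_effect M L.
Qed.

Lemma transition_others c x j : transition c x -> j <> actor x.1 ->
  proc x.2 j = proc c j.
Proof.
by case=> * /=; rewrite /set_proc; case: eqP.
Qed.

Lemma transition_inv c x : inv c -> transition c x -> inv x.2.
Proof.
move=> H T j; have E := transition_effect H T.
case: (eqVneq j (actor x.1)) => [->|/eqP ne]; last first.
  rewrite (transition_others T ne); case: (H j) => R L.
  have ne' : actor x.1 <> j by move=> /esym.
  split; first exact: frame_released E ne' R.
  move: L; case: (proc c j) => [p|o f]; first exact: frame_quiet E ne'.
  by case=> wf L; split=> //; exact: frame_line E ne' L.
case: T {E} => [i o s w e|i o f r e e'|i o f f' w e st wf|i o f w m' pl e M] /=;
  rewrite /proc_inv /set_proc eqxx /=;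
  move: (H i); rewrite e => -[R].
- move=> Q; split; last split; first 1 last.
  + exact: wf_enter.
  + by case: asboolP.
  + by move=> k b a; move: (R k b a).
- case=> _; rewrite e' => L; split=> //.
  by move=> k b a; move: (R k b a); rewrite /= e'.
- case: (stuck_line st) => _ _ e1 [_ L]; rewrite e1; split=> //.
- case=> _ L; split; first exact: moves_released M L R.
  split; first exact: wf_enter.
  exact: moves_line (head_for_unanswered H) M L.
Qed.

Lemma inv_init : inv (init_config I).
Proof.
by move=> i; split=> [j|]; rewrite /ab /quiet /an /head_for /hb /= ?ffunE.
Qed.

End Transitions.

(** * Linearization points *)

Lemma onth_rcons (T : Type) (s : seq T) x k :
  onth (rcons s x) k = if k == size s then Some x else onth s k.
Proof.
rewrite -cats1 onth_cat; case: ltngtP => // e; last by rewrite e subnn.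
by rewrite !onth_default //= ?(ltnW e) // subn_gt0.
Qed.

Lemma state_after_eq (n : nat) (A : object) (S S' : nat -> option (seq_op n A)) k :
  (forall k', k' < k -> S k' = S' k') -> state_after S k = state_after S' k.
Proof.
elim: k => [//|k IH] H /=; rewrite H // IH // => k' lt.
by apply: H; apply: ltnW.
Qed.

Section Ghost.
Variables (n : nat) (A : object).

Notation I := (algorithmU n A).
Notation config := (config I).
Notation Idle := (@Idle n A I).
Notation Busy := (@Busy n A I).
Notation memory := (memory n A).

Implicit Types (m : memory) (i j : 'I_n) (f : uframe n A) (a : cell A) (c : config).

Variable H : nat -> option (event n A).

Definition open t s i (o : operation A) : Prop :=
  [/\ s < t, H s = Some (Inv i o) & forall u r, s < u < t -> H u <> Some (Res i r)].

Lemma openS t s i o :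
  open t.+1 s i o <->
  (s = t /\ H t = Some (Inv i o)) \/ (open t s i o /\ forall r, H t <> Some (Res i r)).
Proof.
split.
  case; rewrite ltnS leq_eqVlt => /orP[/eqP -> e _|lt e N]; first by left.
  right; split; last by move=> r; apply: N; rewrite lt /=.
  by split=> // u r /andP[l1 l2]; apply: N; rewrite l1 ltnW.
case=> [[-> e]|[[lt e N] N']].
  by split=> // u r /andP[l1]; rewrite ltnS leqNgt l1.
split=> //; first exact: ltnW.
move=> u r /andP[l1]; rewrite ltnS leq_eqVlt => /orP[/eqP ->|l2]; first exact: N'.
by apply: N; rewrite l1.
Qed.

Lemma returns_open t s i o r : returns H s t (i, o, r) <->
  open t s i o /\ H t = Some (Res i r).
Proof. by split=> [[]|[[]]]. Qed.

(** [date i] is the date of the last invocation by [i], [res i] its response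
    once it is linearized, and [lin] lists the linearized operations with the
    dates of their invocations. *)
Record ghost := Ghost {
  date : 'I_n -> nat;
  res : 'I_n -> option (response A);
  lin : seq (nat * seq_op n A)
}.

Implicit Types g : ghost.

(** The response moves from [head] to [announce[i]] and then into the local state, and wherever it
    is visible it must be the linearized one. An announced operation that [head] does not show has
    not been linearized. *)
Definition answer m i (l : option (line n A)) (x : option (response A)) : Prop :=
  [/\ forall r, an m i = Rsp r -> x = Some r,
      forall q r, hd m = (q, Some (r, i)) -> x = Some r,
      forall o, an m i = Op o -> ~~ head_for m i -> x = None
    & match l with
      | Some (U0 _) | Some (U1 _) => x = None
      | Some (U17 r) => x = Some r
      | _ => True
      end].

Record ghost_inv t c g : Prop := GhostInv {
  ghost_open : forall i, match proc c i with
    | Defs.Idle _ => forall s o, ~ open t s i o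
    | Defs.Busy o _ => forall s o', open t s i o' <-> s = date g i /\ o' = o
    end;
  ghost_res : forall i o f, proc c i = Busy o f ->
    if res g i is Some r then exists k, onth (lin g) k = Some (date g i, (i, o, r))
    else forall k x, onth (lin g) k <> Some (date g i, x);
  ghost_sound : forall k s i o r, onth (lin g) k = Some (s, (i, o, r)) ->
    (open t s i o /\ res g i = Some r) \/ (exists2 t', t' < t & returns H s t' (i, o,
      r));
  ghost_complete : forall s t' x, t' < t -> returns H s t' x ->
    exists k, onth (lin g) k = Some (s, x);
  ghost_uniq : forall k k' s x x', onth (lin g) k = Some (s, x) ->
    onth (lin g) k' = Some (s, x') -> k = k';
  ghost_order : forall k k' s s' x x', onth (lin g) k = Some (s, x) ->
    onth (lin g) k' = Some (s', x') -> precedes H s s' -> k < k';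
  ghost_spec : forall k s i o r, onth (lin g) k = Some (s, (i, o, r)) ->
    (delta (state_after (onth (map snd (lin g))) k) o).2 = r;
  ghost_state : state_of (map snd (lin g)) = (hd (mem c)).1;
  ghost_answer : forall i, answer (mem c) i (proc_line (proc c i)) (res g i)
}.

(** * The ghost state along a step *)

Definition event_of (l : label n A) : option (event n A) :=
  if l is Event e then Some e else None.

Definition upd (T : Type) (h : 'I_n -> T) i x : 'I_n -> T :=
  fun j => if j == i then x else h j.

Definition linearize g i (o : operation A) (r : response A) : ghost :=
  Ghost (date g) (upd (res g) i (Some r)) (rcons (lin g) (date g i, (i, o, r))).

(** The step may be that of a helper, so [c'] is constrained only through the pending operations,
    the state in [head] and the visible responses. *)
Lemma ghost_linearize t c c' g i o f r :
  ghost_inv t c g -> proc c i = Busy o f -> res g i = None ->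
  H t = None -> 
  (forall j o', (exists f, proc c' j = Busy o' f) <-> (exists f, proc c j = Busy o' f))
    ->
  delta (hd (mem c)).1 o = ((hd (mem c')).1, r) ->
  (forall j, answer (mem c') j (proc_line (proc c' j)) (upd (res g) i (Some r) j)) ->
  ghost_inv t.+1 c' (linearize g i o r).
Proof.
move=> G e eres eH P D An.
have opE s j o' : open t.+1 s j o' <-> open t s j o'.
  rewrite openS eH; split; last by right.
  by case=> [[]|[]].
have fresh k x : onth (lin g) k <> Some (date g i, x).
  by have := ghost_res G e; rewrite eres.
have op_i : open t (date g i) i o.
  by have := ghost_open G i; rewrite e => Hi; apply/Hi.
split=> /=.
- move=> j; have := ghost_open G j.
  case E: (proc c' j) => [x|o' f'].
    case E': (proc c j) => [y|o' f']; first by move=> N s o1 /opE /N.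
    have [_] := P j o'; case; first by exists f'.
    by move=> f1; rewrite E.
  have [] := P j o'; case; first by exists f'.
  move=> f1 e1 _ N s o1; rewrite e1 in N; rewrite opE; exact: N.
- move=> j o' f' e'; rewrite /upd; case: eqVneq => [ej|nj].
    have [f1] : exists f1, proc c j = Busy o' f1 by apply/P; exists f'.
    rewrite ej e => -[<- _]; exists (size (lin g)); by rewrite onth_rcons eqxx.
  have [f1 e1] : exists f1, proc c j = Busy o' f1 by apply/P; exists f'.
  have := ghost_res G e1; case: (res g j) => [r'|].
    case=> k ek; exists k; rewrite onth_rcons; case: eqP => // ek'.
    by rewrite ek' onth_default in ek.
  move=> N k x; rewrite onth_rcons; case: eqP => // _ [ed ex].
  have := ghost_open G j; rewrite e1 => /(_ (date g i) o') [_ Hj].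
  have [_ e3 _] : open t (date g i) j o' by apply: Hj.
  case: op_i => _ e2 _; move: e2; rewrite e3 => -[ej]; by rewrite ej eqxx in nj.
- move=> k s j o' r'; rewrite onth_rcons; case: eqP => _.
    move=> [<- <- <- <-]; left; by rewrite opE /upd eqxx.
  move=> ek; case: (ghost_sound G ek) => [[op er]|[t' lt rt]].
    left; rewrite opE /upd; case: eqP er => // -> er; by rewrite eres in er.
  by right; exists t' => //; apply: ltnW.
- move=> s t' [[j o'] r'] lt rt; have lt' : t' < t.
    move: lt; rewrite ltnS leq_eqVlt => /orP[/eqP et|//].
    by move: rt => /returns_open [_]; rewrite et eH.
  have [k ek] := ghost_complete G lt' rt; exists k; rewrite onth_rcons;
    case: eqP => // ek'.
  by rewrite ek' onth_default in ek.
- move=> k k' s x x'; rewrite !onth_rcons; case: eqP => [ek|_]; case: eqP => [ek'|_].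
  + by rewrite ek ek'.
  + by move=> [<- _] /fresh.
  + by move=> e1 [e2 _]; move: e1; rewrite -e2 => /fresh.
  + exact: (ghost_uniq G).
- have past k0 s0 x0 : onth (lin g) k0 = Some (s0, x0) -> s0 < t.
    case: x0 => [[j o'] r'] /(ghost_sound G) [[[//]]|
      [t' lt /returns_open [[lt' _ _] _]]].
    exact: ltn_trans lt.
  (* The operation is still open, so it precedes nothing invoked so far; appending it at the end
     respects the real-time order. *)
  have noret s' : s' <= t -> ~ precedes H (date g i) s'.
    move=> le [t' [[[j o'] r'] [/returns_open [[l1 e1 _] e2] l2]]].
    case: op_i => _ e3 /(_ t' r'); rewrite l1 (leq_trans l2) // => /(_ isT).
    by move: e3; rewrite e1 => -[ej _] N; apply: N; rewrite e2 ej.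
  move=> k k' s s' x x'; rewrite !onth_rcons; case: eqP => [ek|_]; case: eqP => [ek'|_].
  + case=> <- _ [<- _] /noret []; case: op_i => lt _ _; exact: ltnW.
  + by move=> [<- _] /past /ltnW le /noret.
  + move=> e1 _ _; rewrite ek' ltnNge; apply/negP => le; by rewrite onth_default in e1.
  + exact: (ghost_order G).
- have pre k : k <= size (lin g) ->
    state_after (onth (map snd (rcons (lin g) (date g i, (i, o, r))))) k =
    state_after (onth (map snd (lin g))) k.
    move=> le; apply: state_after_eq => k' lt; rewrite map_rcons onth_rcons size_map.
    by case: eqP => // ek; move: lt; rewrite ek ltnNge le.
  move=> k s j o' r'; rewrite onth_rcons; case: eqP => [->|nk].
    move=> [_ _ <- <-]; rewrite pre //.
    by have := ghost_state G; rewrite /state_of size_map => ->; rewrite D.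
  move=> ek; rewrite pre; first exact: (ghost_spec G ek).
  by rewrite leqNgt; apply/negP => lt; rewrite onth_default // in ek; apply: ltnW.
- rewrite /state_of map_rcons size_rcons /= onth_rcons eqxx.
  rewrite (@state_after_eq _ _ _ (onth (map snd (lin g)))); last first.
    move=> k lt; rewrite onth_rcons; by case: eqP => // ek; rewrite ek ltnn in lt.
  by have := ghost_state G; rewrite /state_of => ->; rewrite D.
- exact: An.
Qed.

Lemma ghost_keep t c c' g : ghost_inv t c g -> H t = None ->
  (forall j o', (exists f, proc c' j = Busy o' f) <-> (exists f, proc c j = Busy o' f))
    ->
  (hd (mem c')).1 = (hd (mem c)).1 ->
  (forall j, answer (mem c') j (proc_line (proc c' j)) (res g j)) ->
  ghost_inv t.+1 c' g.
Proof.
move=> G eH P D An.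
have opE s j o' : open t.+1 s j o' <-> open t s j o'.
  rewrite openS eH; split; last by right.
  by case=> [[]|[]].
split.
- move=> j; have := ghost_open G j.
  case E: (proc c' j) => [x|o' f'].
    case E': (proc c j) => [y|o' f']; first by move=> N s o1 /opE /N.
    have [_] := P j o'; case; first by exists f'.
    by move=> f1; rewrite E.
  have [] := P j o'; case; first by exists f'.
  move=> f1 e1 _ N s o1; rewrite e1 in N; rewrite opE; exact: N.
- move=> j o' f' e'.
  have [f1 e1] : exists f1, proc c j = Busy o' f1 by apply/P; exists f'.
  exact: (ghost_res G e1).
- move=> k s j o' r' /(ghost_sound G) [[op er]|[t' lt rt]]; first by left; rewrite opE.
  by right; exists t' => //; apply: ltnW.
- move=> s t' [[j o'] r'] lt rt; apply: (ghost_complete G _ rt).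
  move: lt; rewrite ltnS leq_eqVlt => /orP[/eqP et|//].
  by move: rt => /returns_open [_]; rewrite et eH.
- exact: (ghost_uniq G).
- exact: (ghost_order G).
- exact: (ghost_spec G).
- by rewrite D; exact: (ghost_state G).
- exact: An.
Qed.

Lemma ghost_invoke t c g i o x w : ghost_inv t c g -> proc c i = Idle x ->
  quiet (mem c) i -> H t = Some (Inv i o) ->
  ghost_inv t.+1 (put c i (Busy o (ustart i o x w)) (mem c))
    (Ghost (upd (date g) i t) (upd (res g) i None) (lin g)).
Proof.
move=> G e Q eH.
have idle s o' : ~ open t s i o' by have := ghost_open G i; rewrite e; apply.
have opE s j o' : j <> i -> open t.+1 s j o' <-> open t s j o'.
  move=> ne; rewrite openS eH; split; first by case=> [[_ [] /esym]|[]].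
  by right.
have past k s y : onth (lin g) k = Some (s, y) -> s < t.
  case: y => [[j o'] r'] /(ghost_sound G) [[[//]]|[t' lt /returns_open [[lt' _ _] _]]].
  exact: ltn_trans lt.
split=> /=.
- move=> j; rewrite /set_proc /upd; case: eqP => [->|ne].
    move=> s o'; rewrite openS eH; split; last by case=> -> ->; left.
    by case=> [[-> [->]]|[/idle]].
  have := ghost_open G j; case: (proc c j) => [y|o1 f1] N s o'; rewrite opE //;
    exact: N.
- move=> j o' f'; rewrite /set_proc /upd; case: eqP => [_|ne].
    by move=> _ k y /past; rewrite ltnn.
  exact: (ghost_res G).
- move=> k s j o' r' /(ghost_sound G) [[op er]|[t' lt rt]].
    have ne : j <> i by move=> ej; rewrite ej in op; case: (idle _ _ op).
    left; rewrite opE //; split=> //; by rewrite /upd; case: eqP.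
  by right; exists t' => //; apply: ltnW.
- move=> s t' [[j o'] r'] lt rt; apply: (ghost_complete G _ rt).
  move: lt; rewrite ltnS leq_eqVlt => /orP[/eqP et|//].
  by move: rt => /returns_open [_]; rewrite et eH.
- exact: (ghost_uniq G).
- exact: (ghost_order G).
- exact: (ghost_spec G).
- exact: (ghost_state G).
- move=> j; rewrite /set_proc /upd; case: eqP => [->|ne]; last exact: (ghost_answer G).
  case: Q => e1 /negP e2 _; split; rewrite ?e1 //=.
    by move=> q r e3; case: e2; rewrite /head_for e3 /= eqxx.
  by case: asboolP.
Qed.

Lemma ghost_return t c g i o f r : ghost_inv t c g -> proc c i = Busy o f ->
  at_line f = U17 n r -> H t = Some (Res i r) ->
  ghost_inv t.+1 (put c i (Idle (priority f)) (mem c)) g.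
Proof.
move=> G e el eH.
have er : res g i = Some r by have [_ _ _] := ghost_answer G i; rewrite e /= el.
have opi s o' : open t s i o' <-> s = date g i /\ o' = o.
  by have := ghost_open G i; rewrite e; apply.
have opE s j o' : j <> i -> open t.+1 s j o' <-> open t s j o'.
  move=> ne; rewrite openS eH; split; first by case=> [[]|[]].
  by right; split=> // r' [/esym].
split=> /=.
- move=> j; rewrite /set_proc; case: eqP => [->|ne].
    move=> s o'; rewrite openS eH; by case=> [[]|[_ /(_ r)]].
  have := ghost_open G j; case: (proc c j) => [y|o1 f1] N s o'; rewrite opE //;
    exact: N.
- move=> j o' f'; rewrite /set_proc; case: eqP => [->//|ne]; exact: (ghost_res G).
- move=> k s j o' r' /(ghost_sound G) [[op er']|[t' lt rt]]; last first.
    by right; exists t' => //; apply: ltnW.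
  case: (eqVneq j i) => [ej|/eqP ne]; last by left; rewrite opE.
  right; exists t => //; apply/returns_open; split=> //.
  by rewrite eH ej; move: er'; rewrite ej er => -[->].
- move=> s t' [[j o'] r'] lt rt.
  move: lt; rewrite ltnS leq_eqVlt => /orP[/eqP et|lt];
    last exact: (ghost_complete G lt rt).
  move: rt => /returns_open [op]; rewrite et eH => -[ei <-].
  move: op; rewrite -ei et => /opi [-> ->].
  by have := ghost_res G e; rewrite er.
- exact: (ghost_uniq G).
- exact: (ghost_order G).
- exact: (ghost_spec G).
- exact: (ghost_state G).
- move=> j; have := ghost_answer G j; rewrite /set_proc; case: eqP => [->|//].
  by case=> *; split.
Qed.

Lemma put_busy c i o f f' m : proc c i = Busy o f ->
  forall j o', (exists f1, proc (put c i (Busy o f') m) j = Busy o' f1) <->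
               (exists f1, proc c j = Busy o' f1).
Proof.
move=> e j o'; rewrite /= /set_proc; case: eqP => [->|//].
rewrite e; split=> -[f1 [<- _]]; by [exists f | exists f'].
Qed.

(** Apart from [Apply], effects only carry responses along: [Respond] copies that of [head] to its
    owner, and [Retire] erases it once it has been copied. *)
Lemma effect_answer k m m' x i l :
  effect k m m' -> (forall j o q, hd m = (q, None) -> an m j = Op o ->
     m' <> set_head m ((delta q o).1, Some ((delta q o).2, j))) ->
  (i = k -> an m k = Bot A -> x = None) ->
  answer m i l x -> answer m' i l x.
Proof.
case=> [|b y|j o q e1 e2|q r j e1 e2|q r j o e1 e2|o e1 e2|e1 e2] na h [a1 a2 a3 a4].
- by split.
- by split; rewrite /head_for ?memE.
- by have := na j o q e1 e2.
- split=> //; rewrite /head_for ?memE //= => o' e3 _; apply: (a3 _ e3).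
  rewrite /head_for e1 /=; apply/eqP => ej; by rewrite ej e3 in e2.
- split=> //; rewrite /head_for ?memE //=.
    by move=> r'; case: eqP => [ei|_]; [move=> [<-]; rewrite -ei in e1;
      exact: a2 e1 | exact: a1].
  by move=> o'; case: eqP => // _; apply: a3.
- split=> //; rewrite /head_for ?memE //=.
    by move=> r'; case: eqP => // _; exact: a1.
  by move=> o'; case: eqP => [ei _ _|_]; [exact: h | exact: a3].
- split=> //; rewrite /head_for ?memE //=.
    by move=> r'; case: eqP => // _; exact: a1.
  by move=> o'; case: eqP => // _; apply: a3.
Qed.

Lemma moves_answer i pr m o l m' pl x : moves i pr m l m' pl -> line_inv m i o l ->
  (forall op, l <> U0 n op) -> answer m i (Some l) x ->
  answer m i (Some pl.2) x.
Proof.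
move=> M L n0 [a1 a2 a3 a4]; split=> //.
case: M L n0 a4 => //=.
- by move=> op _ /(_ op).
- by move=> op _ _ _; case: ifP.
- by move=> op q r j a _ _ _ _; case: ifP.
- by move=> op q r j a _ _ _ _; case: (a).
- by move=> op q j a _ _ _ _; case: (a).
- by move=> op q j a _ _ _ _; case: (a).
- by move=> r [_ e _ _] _ _; exact: a1.
Qed.

Lemma ghost_step t c x g : inv c -> ghost_inv t c g ->
  transition c x -> H t = event_of x.1 ->
  exists2 g', ghost_inv t.+1 x.2 g' & exists s, lin g' = lin g ++ s.
Proof.
move=> Inv0 G T eH.
have same g' : lin g' = lin g -> exists s, lin g' = lin g ++ s.
  by exists [::]; rewrite cats0.
have E := transition_effect Inv0 T.
case: T E eH => [i o y w e|i o f r e el|i o f f' w e st wf|i o f w m' pl e M] /= E eH.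
- exists (Ghost (upd (date g) i t) (upd (res g) i None) (lin g)); last exact: same.
  apply: (ghost_invoke _ G e _ eH).
  by have := Inv0 i; rewrite e => -[].
- exists g; last exact: same.
  exact: ghost_return G e el eH.
- exists g; last exact: same.
  apply: (ghost_keep G eH (put_busy _ _ e)) => // j.
  have := ghost_answer G j; rewrite /= /set_proc; case: eqP => [->|//].
  by rewrite e /=; case: (stuck_line st) => _ _ ->.
have [_ [_ L]] : proc_inv (mem c) i (Busy o f) by rewrite -e.
have lin_ext g0 z : lin g0 = rcons (lin g) z -> exists s, lin g0 = lin g ++ s.
  by move=> ->; exists [:: z]; rewrite cats1.
have An := ghost_answer G.
have Ai := An i; rewrite e /= in Ai.
(* First linearization point: the Load of a read-only operation, which leaves the state as it is. *)
have [[op el]|n0] := pselect (exists op, at_line f = U0 n op).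
  rewrite el in M L Ai; inversion M; subst; move: L => /= [eo ns [q1 q2 q3]].
  have er : res g i = None by case: Ai.
  exists (linearize g i o (delta (hd (mem c)).1 o).2); last exact: lin_ext.
  apply: (ghost_linearize G e er eH (put_busy _ _ e)) => /=.
    have : (delta (hd (mem c)).1 o).1 = (hd (mem c)).1.
      by apply: contrapT => ne; apply: ns; exists (hd (mem c)).1.
    by case: (delta _ o) => q r /= ->.
  move=> j; rewrite /upd /set_proc; case: eqP => [->|_]; last exact: An.
  split=> /=; rewrite ?q1 //; last by rewrite eo.
  by move=> q r eq; move: q2; rewrite /head_for eq /= eqxx.
have n0' op : at_line f <> U0 n op by move=> el; apply: n0; exists op.
have Bi : an (mem c) i = Bot A -> res g i = None.
  move=> eb; case: (line_status L) => [[_ cl]|[[_ _]]]; last by rewrite eb => -[].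
  by case: Ai => _ _ _; case: M cl n0' => //= op _ /(_ op).
have [[j [oj [q [ehd ea em]]]]|
  na] := pselect (exists j oj q, [/\ hd (mem c) = (q, None),
    an (mem c) j = Op oj & m' = set_head (mem c) ((delta q oj).1, Some ((delta q oj).2,
      j))]).
  have [fj ej] : exists fj, proc c j = Busy oj fj.
    have := Inv0 j; case: (proc c j) => [y [_ []]|o' f' [_ [_ /line_status]]].
      by rewrite ea.
    case=> [[[]]|[[_ _]]]; rewrite ea // => -[[->]|//]; by exists f'.
  have nj : ~~ head_for (mem c) j by rewrite /head_for ehd.
  have [_ _ /(_ _ ea nj) er _] := An j.
  exists (linearize g j oj (delta q oj).2); last exact: lin_ext.
  apply: (ghost_linearize G ej er eH (put_busy _ _ e)) => /=.
    by rewrite em memE ehd /=; case: (delta _ _).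
  move=> k; rewrite /upd; split; rewrite /= ?em /head_for ?memE.
  - move=> r; case: eqP => [->|_]; first by rewrite ea.
    by case: (An k) => a _ _ _; exact: a.
  - by move=> q' r [_ <- ->]; rewrite eqxx.
  - move=> o' eo /=; rewrite eq_sym; case: eqP => // _ _.
    by case: (An k) => _ _ /(_ _ eo) -> //; rewrite /head_for ehd.
  (* The last clause of [answer] constrains calm lines only, and neither the acting process after
     its step nor [j] is at one. *)
  - have no_calm (l : option (line n A)) (y : option (response A)) :
        (if l is Some l' then ~~ calm l' else true) -> match l with
        | Some (U0 _) | Some (U1 _) => y = None
        | Some (U17 r) => y = Some r
        | _ => True
        end.
      by case: l => // -[].
    have ncl : ~~ calm pl.2.
      have : hd m' <> hd (mem c) by rewrite em memE ehd.
      case: M n0' => //=; try by move=> *; case: ifP.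
      + by move=> op q' j' a _ _ _; case: (a).
      + by move=> r _; rewrite memE.
    rewrite /set_proc; case: (eqVneq k i) => [_|ki];
      first exact: (no_calm (Some pl.2) _ ncl).
    case: eqP => [->|_]; last by case: (An k).
    apply: no_calm; have := Inv0 j; rewrite ej => -[_ [_ /line_status]].
    by case=> [[[]]|[]]; rewrite ?ea.
exists g; last exact: same.
apply: (ghost_keep G eH (put_busy _ _ e)) => /=.
  case: E na {An Ai M} => [|b y|j o' q e1 e2|q r j e1 e2|q r j o' e1 e2|o' e1 e2|
    e1 e2] na;
    rewrite ?memE ?e1 //.
  by case: na; exists j, o', q.
move=> j; apply: (effect_answer E).
- by move=> j' oj q e1 e2 e3; apply: na; exists j', oj, q.
- by move=> ->.
rewrite /set_proc; case: eqP => [->|_]; last exact: An.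
exact: moves_answer M L n0' Ai.
Qed.

End Ghost.

(** * Linearizability and history independence *)

(** [ghost_step] gives one ghost state at a time, while the linearization of an infinite execution
    needs a whole coherent sequence of them. *)
Lemma dependent_choice (T : Type) (P : nat -> T -> Prop) (R : nat -> T -> T -> Prop) x0
  :
  P 0 x0 -> (forall t x, P t x -> exists2 y, P t.+1 y & R t x y) ->
  exists f : nat -> T, forall t, P t (f t) /\ R t (f t) (f t.+1).
Proof.
move=> H0 HS.
have next t (x : {x | P t x}) : {y : {y | P t.+1 y} | R t (projT1 x) (projT1 y)}.
  case: x => x Hx; apply: cid; case: (HS t x Hx) => y Py Ry.
  by exists (exist _ y Py).
pose f := fix f t : {x | P t x} :=
  if t is t'.+1 then projT1 (next t' (f t')) else exist _ x0 H0.
exists (fun t => projT1 (f t)) => t; split; first exact: projT2 (f t).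
exact: projT2 (next t (f t)).
Qed.

Section Safety.
Variables (n : nat) (A : object).

Notation I := (algorithmU n A).
Notation config := (config I).
Notation Idle := (@Idle n A I).
Notation Busy := (@Busy n A I).
Notation memory := (memory n A).
Notation ghost := (ghost n A).
Notation trace := (trace I).

Implicit Types (m : memory) (i j : 'I_n) (f : uframe n A) (c : config) (tr : trace).

(** Total version of [config_at]: after the end of a finite execution the last configuration is
    repeated. *)
Fixpoint cfg tr t : config :=
  if t is t'.+1 then if tr t' is Some x then x.2 else cfg tr t' else init_config I.

Lemma cfg_at tr t c : config_at tr t = Some c -> cfg tr t = c.
Proof. by case: t => [[]|t] //=; case: (tr t) => //= x []. Qed.

Lemma cfg_step tr t x : execution tr -> tr t = Some x -> step (cfg tr t) x.
Proof. by move=> E e; case: (E t x e) => c /cfg_at ->. Qed.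

Lemma inv_cfg tr t : execution tr -> inv (cfg tr t).
Proof.
move=> E; elim: t => [|t IH] /=; first exact: inv_init.
case e: (tr t) => [x|//]; apply: (transition_inv IH).
by apply: step_transition => //; apply: cfg_step.
Qed.

Lemma cfg_transition tr t x : execution tr -> tr t = Some x -> transition (cfg tr t) x.
Proof. by move=> E e; apply: step_transition; [exact: inv_cfg | exact: cfg_step]. Qed.

Lemma ghost_init H : ghost_inv H 0 (init_config I)
  (Ghost (fun=> 0) (fun=> None) [::] : ghost).
Proof.
split=> //=.
- by move=> i s o [].
- by case.
- by case.
- by case.
- by case.
Qed.

Lemma ghost_trace tr : execution tr -> exists g : nat -> ghost, forall t,
  ghost_inv (history_of tr) t (cfg tr t) (g t) /\
  ((exists s, lin (g t.+1) = lin (g t) ++ s) /\ (tr t = None -> g t.+1 = g t)).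
Proof.
move=> E; apply: (@dependent_choice _
  (fun t g => ghost_inv (history_of tr) t (cfg tr t) g)
  (fun t g g' => (exists s, lin g' = lin g ++ s) /\ (tr t = None -> g' = g)) _
  (ghost_init _)) => t g G /=.
case e: (tr t) => [x|].
  have eH : history_of tr t = event_of x.1 by rewrite /history_of e; case: x {e} => -[].
  have [g' G' ext] := ghost_step (inv_cfg t E) G (cfg_transition E e) eH.
  by exists g'.
exists g; last by split=> //; exists [::]; rewrite cats0.
have eH : history_of tr t = None by rewrite /history_of e.
by apply: (ghost_keep G eH) => // j; exact: (ghost_answer G).
Qed.

(** * Linearization as the limit of the ghost lists *)

Section Limit.
Variables (tr : trace) (g : nat -> ghost).
Hypothesis G : forall t, ghost_inv (history_of tr) t (cfg tr t) (g t).
Hypothesis ext : forall t, exists s, lin (g t.+1) = lin (g t) ++ s.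
Variable L : nat -> option (nat * seq_op n A).
Hypothesis L_lin : forall t k e, onth (lin (g t)) k = Some e -> L k = Some e.
Hypothesis lin_L : forall k e, L k = Some e -> exists t, onth (lin (g t)) k = Some e.

Lemma lin_mono t t' k e : t <= t' ->
  onth (lin (g t)) k = Some e -> onth (lin (g t')) k = Some e.
Proof.
move=> le H; elim: t' le => [|t' IH]; first by rewrite leqn0 => /eqP <-.
rewrite leq_eqVlt => /orP[/eqP <- //|]; rewrite ltnS => /IH {}IH.
case: (ext t') => s ->; rewrite onth_cat; case: ltnP => // le.
by rewrite onth_default in IH.
Qed.

Lemma lin_L2 k k' e e' : L k = Some e -> L k' = Some e' ->
  exists t, onth (lin (g t)) k = Some e /\ onth (lin (g t)) k' = Some e'.
Proof.
move=> /lin_L [t H] /lin_L [t' H']; exists (maxn t t').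
by split; [apply: lin_mono H | apply: lin_mono H']; rewrite (leq_maxl, leq_maxr).
Qed.

Lemma L_inv k s i o r : L k = Some (s, (i, o, r)) -> history_of tr s = Some (Inv i o).
Proof.
by move=> /lin_L [t /(ghost_sound (G t)) [[[_ //]]|[t' _ /returns_open [[]]]]].
Qed.

Lemma L_uniq k k' s x x' : L k = Some (s, x) -> L k' = Some (s, x') -> k = k' /\ x = x'.
Proof.
move=> H H'; case: (lin_L2 H H') => t [e e'].
have ek := ghost_uniq (G t) e e'; split=> //.
by move: H'; rewrite -ek H => -[].
Qed.

(** The lists [lin (g t)] extend each other, and each condition concerns finitely many positions of
    [L], which all lie in one of these lists. Keeping [L] abstract serves infinite executions, where
    it is a union, and finite ones, where it is the last list. *)
Lemma linearization_limit : linearization (history_of tr) (fun k => omap snd (L k)).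
Proof.
(* A pending operation is completed exactly when it occurs in [L], with the response that it has
   there. *)
pose compl s : option (response A) :=
  if pselect (exists r k i o, L k = Some (s, (i, o, r))) is left e then Some (projT1
    (cid e))
  else None.
exists compl, (fun k => if L k is Some e then e.1 else 0).
split.
  move=> k; case e: (L k) => // _; case e': (L k.+1) => [x|//].
  have [t e2] := lin_L e'; have lt : k < size (lin (g t)).
    by rewrite ltnW // ltnNge; apply/negP => le; rewrite onth_default in e2.
  by case e3: (onth (lin (g t)) k) (onthTE (lin (g t)) k) => [y|];
    [rewrite (L_lin e3) in e | rewrite lt].
split.
  move=> k x; case e: (L k) => [[s [[i o] r]]|] //= [<-].
  have eI := L_inv e.
  have [[t1 [r1 [lt1 e1]]]|
    N] := pselect (exists t r', s < t /\ history_of tr t = Some (Res i r')).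
    (* The matching response is the first one by [i] after the invocation, and it must agree with
       [L] by uniqueness of dates. *)
    pose P t := `[< s < t /\ exists r', history_of tr t = Some (Res i r') >].
    have exP : exists t, P t by exists t1; apply/asboolP; split=> //; exists r1.
    case: (ex_minnP exP) => t2 /asboolP [lt2 [r2 e2]] min; left; exists t2.
    have rt : returns (history_of tr) s t2 (i, o, r2).
      split=> // u r' /andP[l1 l2] e3; have /min : P u by apply/asboolP; split=> //;
        exists r'.
      by rewrite leqNgt l2.
    have [k' /L_lin e3] := ghost_complete (G t2.+1) (ltnSn _) rt.
    by case: (L_uniq e e3) => _ [->].
  right; split; first by split=> // t r' lt e1; apply: N; exists t, r'.
  rewrite /compl; case: pselect => [e1|[]]; last by exists r, k, i, o.
  case: (cid e1) => r1 [k1 [i1 [o1 /(L_uniq e) [_ [_ _ ->]]]]] //.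
split.
  move=> k k' x x'; case e: (L k) => [[s y]|] //= _;
    case e': (L k') => [[s' y']|] //= _ es.
  by rewrite -es in e'; case: (L_uniq e e').
split.
  move=> s [[i o] r] [[t rt]|[[eI N]]].
    have [k /L_lin e] := ghost_complete (G t.+1) (ltnSn _) rt.
    by exists k; rewrite e.
  rewrite /compl; case: pselect => // e1 [<-]; case: (cid e1) => r1 [k [i1 [o1 e]]] /=.
  exists k; rewrite e //=; have := L_inv e; by rewrite eI => -[-> ->].
split.
  move=> k k' x x'; case e: (L k) => [[s y]|] //= _;
    case e': (L k') => [[s' y']|] //= _ p.
  by case: (lin_L2 e e') => t [e1 e2]; apply: ghost_order (G t) _ _ _ _ _ _ e1 e2 p.
move=> k i o r; case e: (L k) => [[s y]|] //= [ey]; rewrite ey in e.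
have [t e1] := lin_L e; rewrite -[RHS](ghost_spec (G t) e1).
congr (delta _ _).2; apply: state_after_eq => k' lt; rewrite onth_map.
case e2: (onth (lin (g t)) k') => [z|]; first by rewrite (L_lin e2).
have := onthTE (lin (g t)) k'; rewrite e2 /=.
suff -> : k' < size (lin (g t)) by [].
by apply: ltn_trans lt _; rewrite ltnNge; apply/negP => le; rewrite onth_default in e1.
Qed.

End Limit.

Theorem algorithmU_linearizable : linearizable I.
Proof.
move=> tr E; have [g Hg] := ghost_trace E.
have G t := (Hg t).1; have ext t := (Hg t).2.1.
pose L k : option (nat * seq_op n A) :=
  if pselect (exists e t, onth (lin (g t)) k = Some e) is left e then Some (projT1 (cid
    e)) else None.
exists (fun k => omap snd (L k)); apply: (linearization_limit G ext).
  move=> t k e H; rewrite /L; case: pselect => [e1|[]]; last by exists e, t.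
  case: (cid e1) => e' [t' H'] /=.
  have := lin_mono ext (leq_maxl t t') H; by rewrite (lin_mono ext (leq_maxr t t') H').
by move=> k e; rewrite /L; case: pselect => // e1 [<-]; case: (cid e1).
Qed.

Lemma final_cfg (a : seq (label n A * config)) : final a = cfg (onth a) (size a).
Proof.
case/lastP: a => [//|a x]; rewrite /final map_rcons last_rcons size_rcons /=.
by rewrite onth_rcons eqxx.
Qed.

Lemma linearization_final (a : seq (label n A * config)) : execution (onth a) ->
  exists2 h : seq (seq_op n A), linearization (history_of (onth a)) (onth h) &
    state_of h = (hd (mem (final a))).1.
Proof.
move=> E; have [g Hg] := ghost_trace E.
have G t := (Hg t).1; have ext t := (Hg t).2.1.
exists (map snd (lin (g (size a)))); last by rewrite final_cfg;
  exact: (ghost_state (G _)).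
have stop t : size a <= t -> g t = g (size a).
  elim: t => [|t IH]; first by rewrite leqn0 => /eqP ->.
  rewrite leq_eqVlt => /orP[/eqP <- //|]; rewrite ltnS => le; rewrite -IH //.
  by apply: (Hg t).2.2; rewrite onth_default.
have -> : onth (map snd (lin (g (size a)))) = fun k => omap snd (onth (lin (g (size
  a))) k).
  by apply: funext => k; rewrite onth_map.
apply: (linearization_limit G ext); last by move=> k e; exists (size a).
move=> t k e H; case: (leqP t (size a)) => [le|/ltnW /stop <- //].
exact: (lin_mono ext le H).
Qed.

(** Every process is idle or read-only, hence quiet and with no release due. All links are then
    gone, and the memory is a function of the state in [head]. *)
Lemma quiescent_mem c : inv c -> state_quiescent c -> forall b,
  mem c b = if b is Some j then clear n (Bot A : uval A (Some j))
            else clear n ((hd (mem c)).1, None).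
Proof.
move=> Hc Q.
have H i : quiet (mem c) i /\ forall j, must_release (proc_line (proc c i)) j = false.
  have [_] := Hc i; case e: (proc c i) => [x|o f] //= [_ /line_status].
  case=> [[q]|[[_ s _] _]]; last by case: (Q _ _ _ e).
  by case: (at_line f).
case=> [j|].
  rewrite (surjective_pairing (mem c (Some j))); congr (_, _).
    by case: (H j) => -[].
  apply/ffunP => k; rewrite ffunE; apply/negP => b; have [R _] := Hc k.
  by have := R j b; case: (H k) => _ ->; case: (H j) => -[-> _ _] _ /(_ erefl).
rewrite (surjective_pairing (mem c None)); congr (_, _); last first.
  by apply/ffunP => k; rewrite ffunE; case: (H k) => -[].
rewrite (surjective_pairing (mem c None).1); congr (_, _).
case e: (mem c None).1.2 => [[r j]|//]; case: (H j) => -[_ /negP []].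
by rewrite /head_for /hd e /= eqxx.
Qed.

Theorem algorithmU_state_quiescent_HI : state_quiescent_HI I.
Proof.
have hP (a : seq (label n A * config)) : exists h, execution (onth a) ->
    linearization (history_of (onth a)) (onth h) /\ state_of h = (hd (mem (final a))).1.
  (* [h] must be total; on sequences that are not executions it takes the empty history. *)
  have [E|N] := pselect (execution (onth a)); last by exists [::].
  by have [h H1 H2] := linearization_final E; exists h.
exists (fun a => projT1 (cid (hP a))); split.
  by move=> a E; case: (cid (hP a)) => h /= /(_ E) [].
move=> a a' E E' Q Q'; case: (cid (hP a)) => h /= /(_ E) [_ ->].
case: (cid (hP a')) => h' /= /(_ E') [_ ->] e b.
have Ha : inv (final a) by rewrite final_cfg; apply: inv_cfg.
have Ha' : inv (final a') by rewrite final_cfg; apply: inv_cfg.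
by rewrite (quiescent_mem Ha Q) (quiescent_mem Ha' Q') e.
Qed.

End Safety.

(** * Potentials *)

Lemma eventually_stable (f : nat -> nat) T : (forall t, T <= t -> f t.+1 <= f t) ->
  exists2 T', T <= T' & forall t, T' <= t -> f t = f T'.
Proof.
move: {2}(f T).+1 (ltnSn (f T)) => N; elim: N T => // N IH T lt mono.
have [[T1 le1 lt1]|N1] := pselect (exists2 T1, T <= T1 & f T1 < f T).
  case: (IH T1 (leq_trans lt1 lt)) => [t le|T' le' st];
    first exact: mono (leq_trans le1 le).
  by exists T' => //; exact: leq_trans le'.
exists T => // t le; apply/eqP; rewrite eqn_leq; apply/andP; split.
  elim: t le => [|t IHt]; first by rewrite leqn0 => /eqP ->.
  rewrite leq_eqVlt => /orP[/eqP <- //|]; rewrite ltnS => le.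
  exact: leq_trans (mono _ le) (IHt le).
by rewrite leqNgt; apply/negP => lt'; apply: N1; exists t.
Qed.

Lemma eventually_forall (n : nat) (P : 'I_n -> nat -> Prop) T :
  (forall k, exists2 T', T <= T' & forall t, T' <= t -> P k t) ->
  exists2 T', T <= T' & forall t, T' <= t -> forall k, P k t.
Proof.
move=> H; pose B k := projT1 (cid2 (H k)).
exists (maxn T (\max_k B k)); first exact: leq_maxl.
move=> t le k; have : B k <= t.
  by apply: leq_trans le; rewrite leq_max (leq_bigmax k) orbT.
by rewrite /B; case: (cid2 (H k)) => /= T' _; apply.
Qed.

Section Potentials.
Variables (n : nat) (A : object).

Notation head := (@None 'I_n).
Notation announce := (@Some 'I_n).
Notation memory := (memory n A).

Implicit Types (m : memory) (i j k : 'I_n).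

(** [Apply] and [Retire] fill and clear the response component, so neither rewrites the same value.
    While the value stays, a link is changed by its owner only. [effect_ab] is the analogue for
    announcements. *)
Lemma effect_hb i k m m' : effect i m m' -> k <> i -> hd m' = hd m -> hb m' k = hb m k.
Proof.
move=> E ne; have nek : (k == i) = false by apply/eqP.
by case: E => [|b x|j o q e _|q r j e _|q r j o _ _|o _ _|_ _] e';
  rewrite ?memE ?nek ?andbF // in e' *; rewrite e in e'.
Qed.

Lemma effect_ab i k j m m' : effect i m m' -> k <> i -> an m' j = an m j ->
  ab m' j k = ab m j k.
Proof.
move=> E ne; have nek : (k == i) = false by apply/eqP.
case: E => [|b x|j' o q e _|q r j' e _|q r j' o _ e|o e _|e _] e';
  rewrite ?memE ?nek ?andbF // in e' *; case: eqP e' => // ->.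
- by rewrite e.
- by rewrite e.
- by move=> e'; rewrite -e' in e.
Qed.

(** Holds from the application of the operation of [k] until its withdrawal, so it cannot become
    true while the value of [head] is fixed. *)
Definition owes m k : bool := is_rsp (an m k) || head_for m k.

Lemma effect_owes i k m m' : effect i m m' -> hd m' = hd m -> owes m' k -> owes m k.
Proof.
move=> E e'; rewrite /owes /head_for e'.
case: E {e'} => [|b x|j o q e _|q r j e _|q r j o e e1|o _ _|_ _]; rewrite ?memE //.
- by case: eqP => // ->; rewrite e /= eqxx orbT.
- by case: eqP => //= _ ->; rewrite orbT.
- by case: eqP => //= _ ->; rewrite orbT.
Qed.

Definition at16 (l : option (line n A)) : bool := if l is Some (U16 _) then true else
  false.

(** While the value of [head] does not change, a process that links itself to
    [head] unlinks itself at most once, on its way out. *)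
Definition head_pot m k l : nat := (owes m k && ~~ at16 l) * 2 + ~~ hb m k.

Lemma moves_head_pot i pr m o l m' pl : moves i pr m l m' pl -> line_inv m i o l ->
  hd m' = hd m -> head_pot m' i (Some pl.2) <= head_pot m i (Some l) /\
  (head_pot m' i (Some pl.2) = head_pot m i (Some l) -> hb m' i = hb m i).
Proof.
move=> M L e; have := effect_owes (k := i) (moves_effect M L) e.
have W : at16 (Some l) -> owes m' i = false.
  case: M L {e} => //= r [_ _ /negbTE h _]; by move: h;
    rewrite /owes /head_for !memE eqxx.
have at16_after op j a : at16 (Some (after10 op j a)) = false by case: (a).
rewrite /head_pot; case: M L e W => {l m' pl} /=.
all: rewrite ?at16_after.
all: try by move=> *; rewrite ?memE ?eqxx /=;
  repeat match goal with H : is_true (owes _ _) -> _ |- _ => move: H end;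
  case: (owes _ i); case: (owes _ i); case: (hb m i) => // /(_ isT).
- by move=> *; case: ifP.
- by move=> op sr j h [_ /(_ h) [q [o' [e _ _]]]]; rewrite memE e.
- by move=> *; case: ifP.
- by move=> op q r j a *; case: (a).
- by move=> op q j a h [_ _ /(_ h) [[r e] _]]; rewrite memE e.
- by move=> op q j a *; case: (a).
- by move=> r q h [_ _ /(_ h) [r' e] _]; rewrite memE e.
- move=> r [_ e _] _ _ _; have -> : owes m i by rewrite /owes e.
  by rewrite andbF !memE !eqxx; case: (hb m i).
- by move=> r _ _ /(_ isT) -> _; rewrite !memE !andbF.
Qed.

(** The next two potentials bound the changes of the link of process [k] to
    [announce[j]] while the value of [announce[j]] does not change: the first
    one when [head] holds no response for [j], the second one when it holds a
    fixed response for [j]. *)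
Definition visit (l : option (line n A)) j : nat :=
  match l with
  | Some (U9 _ _ _ j') => (j' == j) * 4
  | Some (U9_RL j') | Some (U10_VL _ _ _ j' _) | Some (U10_ann _ _ _ j' _)
  | Some (U10_head _ _ j' _) | Some (U11 _ j') => (j' == j) * 2
  | _ => 0
  end.

Definition visit_pot m k j l : nat := visit l j + ~~ ab m j k.

Lemma moves_visit_pot i pr m o j l m' pl : moves i pr m l m' pl -> line_inv m i o l ->
  an m' j = an m j -> ~~ head_for m j ->
  visit_pot m' i j (Some pl.2) <= visit_pot m i j (Some l) /\
  (visit_pot m' i j (Some pl.2) = visit_pot m i j (Some l) -> ab m' j i = ab m j i).
Proof.
have after op j' a : visit (Some (after10 op j' a)) j <= (j' == j) * 2 by case: (a).
have annE j' : (announce j' == announce j) = (j' == j) by [].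
rewrite /visit_pot; case=> {l m' pl} /=.
all: try by move=> *; rewrite ?memE; case: ifP.
all: try by move=> *; rewrite ?memE //; case: (_ == j); case: (ab m j i).
- move=> op [_ _ [e _ _]]; rewrite !memE; case: eqP => //= ->; by rewrite e.
- move=> op q r j0 e _ _; rewrite /head_for e /= => /negbTE ->.
  by rewrite !memE /=; case: (ab m j i).
- move=> op q r j0 _ _ _; rewrite !memE annE eqxx andbT.
  by case: eqP; case: (ab m j i).
- move=> j0 _ _ _; rewrite !memE annE eqxx andbT; by case: eqP; case: (ab m j i).
- by move=> op q r j0 [|o'|r'] * /=; case: eqP; case: (ab m j i).
- move=> op q r j0 a h [_ oa /(_ h) [e _] _]; rewrite !memE [j == j0]eq_sym.
  case: eqP => [<-|_] //= e'; by rewrite -e' in e; rewrite -e in oa.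
- by move=> op q j0 [|o'|r'] * /=; rewrite !memE; case: eqP; case: (ab m j i).
- by move=> op q j0 [|o'|r'] * /=; case: eqP; case: (ab m j i).
- move=> op j0 _ _ _; rewrite !memE annE eqxx andbT; by case: eqP; case: (ab m j i).
- move=> r [_ e _ _]; rewrite !memE; case: eqP => //= ->; by rewrite e.
Qed.

Definition before12 (l : option (line n A)) : bool :=
  match l with
  | Some (U12) | Some (U13 _) | Some (U14 _ _) | Some (U15 _) | Some (U16 _) | Some
    (U17 _) => false
  | _ => true
  end.

Definition serve_pot m k j l : nat :=
  (owes m k && before12 l) * 4 + must_release l j * 2 + ~~ ab m j k.

Lemma moves_serve_pot i pr m o j l m' pl : moves i pr m l m' pl -> line_inv m i o l ->
  an m' j = an m j -> hd m' = hd m -> head_for m j -> an m j <> Bot A ->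
  serve_pot m' i j (Some pl.2) <= serve_pot m i j (Some l) /\
  (serve_pot m' i j (Some pl.2) = serve_pot m i j (Some l) -> ab m' j i = ab m j i).
Proof.
move=> M L ea eh hf nb; have := effect_owes (k := i) (moves_effect M L) eh.
have annE j' : (announce j' == announce j) = (j' == j) by [].
rewrite /serve_pot; case: M L ea eh => {l m' pl} /=.
all: try by move=> *; rewrite ?memE ?annE;
  repeat match goal with H : is_true (owes _ _) -> _ |- _ => move: H end;
  case: (owes _ i); case: (owes _ i); case: (ab m j i) => // /(_ isT).
- move=> op [_ _ [e _ _]]; rewrite !memE; case: eqP => [->|_] /=; first by rewrite e.
  by move=> _ _; case: (owes _ i); case: (owes m i); case: (ab m j i) => // /(_ isT).
- by move=> op *; case: ifP; case: (owes m i); case: (ab m j i).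
- move=> op q r j0 _ _ _.
  have -> : (match an m j0 with Bot => j0 == j | _ => false end) = false.
    by case: eqP => [->|_]; [case: (an m j) nb | case: (an m j0)].
  rewrite !memE annE eqxx andbT; case: eqP => _.
    by case: (owes _ i); case: (owes m i); case: (ab m j i) => // /(_ isT).
  by case: (owes _ i); case: (owes m i); case: (ab m j i) => // /(_ isT).
- move=> j0 [_ e] _ _ _; have -> : owes m i by rewrite /owes e.
  by rewrite andbF !memE annE eqxx andbT; case: eqP; case: (ab m j i).
- by move=> op q r j0 a h [_ _ /(_ h) [_ na _]] _ _ _; case: ifP; case: a na => //;
    case: (owes m i); case: (ab m j i).
- by move=> op q r j0 [|o'|r'] *; rewrite /=; case: (owes m i); case: (j0 == j);
    case: (ab m j i).
- move=> op q r j0 a h [_ oa /(_ h) [e _] _]; rewrite !memE [j == j0]eq_sym.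
  case: eqP => [<-|_] /= e'; first by rewrite -e' in e; rewrite -e in oa.
  by move=> _; case: (owes _ i); case: (owes m i); case: (ab m j i) => // /(_ isT).
- by move=> op q j0 a h [_ _ /(_ h) [[r e] _]]; rewrite !memE e.
- by move=> op q j0 [|o'|r'] h [_ na _] *; rewrite /=; case: (owes m i);
    case: (ab m j i).
- move=> op j0 _ _ _; rewrite !memE annE eqxx andbT.
  by case: (owes _ i); case: (owes m i); case: eqP; case: (ab m j i) => //= _ /(_ isT).
- move=> r [_ e _ _]; rewrite !memE; case: eqP => [->|_] /=; first by rewrite e.
  by rewrite !andbF.
Qed.

End Potentials.

(** * Ranks *)

Section Ranks.
Variables (n : nat) (A : object).

Notation head := (@None 'I_n).
Notation announce := (@Some 'I_n).
Notation memory := (memory n A).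

Implicit Types (m : memory) (i j k : 'I_n) (l : line n A).

Definition answered_rank l : nat :=
  match l with
  | U0 _ | U1 _ => 13
  | U3 _ => 12 | U5_help _ _ => 11 | U5_own _ _ => 10 | U7 _ _ _ => 9
  | U9 _ _ _ _ => 11 | U10_VL _ _ _ _ _ => 10 | U10_ann _ _ _ _ _ => 9
  | U10_head _ _ _ _ => 8 | U11 _ _ => 7 | U2 _ => 6 | U9_RL _ => 6
  | U12 => 5 | U13 _ => 4 | U14 _ _ | U15 _ => 3 | U16 _ => 2 | U17 _ => 1
  end.

Lemma moves_answered i pr m o l m' pl : moves i pr m l m' pl -> line_inv m i o l ->
  is_rsp (an m i) -> (forall r, pl.2 <> U17 n r) ->
  is_rsp (an m' i) /\ answered_rank pl.2 < answered_rank l.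
Proof.
have after op j a : answered_rank (after10 op j a) < 8 by case: a.
case=> {l m' pl} /=.
all: try by move=> *; rewrite ?memE.
- by move=> op [_ _ [-> _ _]].
- by move=> op _ ->.
- by move=> op q r j a *; case: ifP.
- by move=> op q r j a *; split=> //; apply: leq_trans (after op j a) _.
- by move=> op q r j a *; rewrite memE; case: eqP.
- by move=> /negbTE ->.
- by move=> r _ _ /(_ r).
Qed.

(** Ranks towards a successful SC on [head] for a process linked to [head],
    and towards a new LL for a process that is not. *)
Definition pending_rank (linked : bool) l : nat :=
  if linked then
    match l with
    | U2 _ => 10 | U3 _ => 9 | U5_help _ _ => 8 | U5_own _ _ => 7 | U7 _ _ _ => 1
    | U9 _ _ _ _ => 8 | U10_VL _ _ _ _ _ => 7 | U10_ann _ _ _ _ _ => 6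
    | U10_head _ _ _ _ => 1 | U11 _ _ => 11 | _ => 0
    end
  else
    match l with
    | U5_help _ _ => 5 | U5_own _ _ => 4 | U7 _ _ _ => 3
    | U9 _ _ _ _ => 6 | U10_VL _ _ _ _ _ => 5 | U10_ann _ _ _ _ _ => 4
    | U10_head _ _ _ _ => 3 | U11 _ _ => 2 | U2 _ => 1 | _ => 0
    end.

Lemma moves_pending i pr m o l m' pl b : moves i pr m l m' pl -> line_inv m i o l ->
  an m i = Op o -> hb m i = b -> hb m' i = b ->
  pending_rank b pl.2 < pending_rank b l.
Proof.
have after' op j a : pending_rank false (after10 op j a) < 3 by case: a.
move=> M L e; case: M L => {l m' pl} /=; rewrite ?e //.
all: try by case: b.
all: try by move=> op q *; case: b.
all: try by move=> ? [_ //].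
all: try by move=> ? ? [_ //].
- by move=> op [_ _ [e' _ _]]; rewrite e in e'.
- by move=> op [_ _ [e' _ _]]; rewrite e in e'.
- by move=> op q _ _ <-; rewrite memE !eqxx => <-.
- by move=> op q r j _ _ <-; rewrite memE !eqxx => <-.
- by move=> op sr j h _ <-; rewrite memE h.
- by move=> op sr j -> _ <-.
- by move=> op q r j a h [_ _ /(_ h) [_ na _]]; rewrite h => <- _; case: (a) na.
- by move=> op q r j a -> _ <- _; apply: leq_trans (after' op j a) _.
- by move=> op q j a h _ <-; rewrite memE h.
- by move=> op q j a -> _ <- _; exact: after'.
- by move=> r q _ [].
- by move=> r q _ [].
Qed.

(** With [head] fixed, [announce[j]] can only go from operation to response if [head] is for [j],
    and from response to bottom to operation otherwise. *)
Definition ann_rank m j : nat :=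
  match an m j with
  | Op _ => head_for m j | Bot => 1 | Rsp _ => if head_for m j then 0 else 2
  end.

Lemma effect_ann_rank k m m' j : effect k m m' -> hd m' = hd m ->
  ann_rank m' j <= ann_rank m j /\ (ann_rank m' j = ann_rank m j -> an m' j = an m j).
Proof.
move=> E e'; rewrite /ann_rank /head_for e'.
case: E e' => [|b x|j' o q e _|q r j' e _|q r j' o e e1|o e1 h|e1 h]; rewrite ?memE //.
- by move=> _; case: eqP => // ->; rewrite e1 e /= eqxx.
- by move=> _; case: eqP => // ->; move: h; rewrite e1 /head_for => /negbTE ->.
- by move=> _; case: eqP => // ->; move: e1 h; rewrite /head_for;
    case: (an m k) => //= r _ /negbTE ->.
Qed.

(** The number of cyclic advances that take the priority from [p] to [i]. *)
Definition distance (p i : 'I_n) : nat := if p <= i then i - p else i + n - p.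

Lemma distance_ordS p i : p <> i -> distance (ordS p) i < distance p i.
Proof.
move=> ne; have {}ne : (p : nat) != i by apply/eqP => /val_inj.
have lp := ltn_ord p; have li := ltn_ord i; rewrite /distance /=.
move: lp; rewrite leq_eqVlt => /orP[/eqP ep|lt].
  rewrite ep modnn leq0n subn0; case: (leqP p i) => [le|_].
    by case/eqP: ne; apply/eqP; rewrite eqn_leq le -ltnS ep.
  by rewrite -addnBA ?(ltnW (ltn_ord p)) // -[X in X < _]addn0 ltn_add2l subn_gt0
    ltn_ord.
rewrite modn_small //; case: (ltngtP p i) ne => // h _.
  by rewrite subnS prednK // subn_gt0.
by rewrite subnS prednK // subn_gt0 ltn_addl // ltnW.
Qed.

(** A process with priority [i] that reads [announce[i]] while it holds an
    operation can apply no operation but that one. *)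
Definition favors i (p : 'I_n) l : Prop :=
  match l with U7 _ _ j => p = i -> j = i | U5_own _ _ => p <> i | _ => True end.

Lemma moves_favors i k p m o oi l m' pl : moves k p m l m' pl -> line_inv m k o l ->
  an m i = Op oi -> ~~ head_for m' i -> favors i p l ->
  favors i pl.1 pl.2 /\
  (pl.1 = p /\ (~~ (hd m).2 -> ~~ (hd m').2) \/ pl.1 = ordS p /\ p <> i).
Proof.
have after op j a : favors i p (after10 op j a) by case: a.
move=> M L e; case: M L => {l m' pl} /=; rewrite /head_for.
all: try by move=> *; rewrite ?memE; split=> //; left.
- by move=> *; split; [case: ifP | left].
- move=> op q na _ _ _; split; last by left.
  by move=> ep; move: na; rewrite ep e.
- move=> op sr j _ _; rewrite memE /= => ne H; split=> //; right; split=> // /H ej.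
  by rewrite ej eqxx in ne.
- by move=> *; split; [case: ifP | left].
Qed.

Lemma moves_apply k p m l m' pl : moves k p m l m' pl ->
  ~~ (hd m).2 -> (hd m').2 -> exists op, pl.2 = U2 n op.
Proof.
move=> M h; case: M => {l m' pl} /=; rewrite ?(negbTE h) //.
all: try by move=> *; eexists.
all: by move=> *; match goal with H : is_true (isSome (hd _).2) |- _ => move: H end;
  rewrite memE ?(negbTE h).
Qed.

End Ranks.

(** * Progress *)

(** The length of each turn in [S || T] is a free choice made when the turn starts, so no single
    number bounds the remaining steps in advance. *)
Definition lex (p q : nat * nat) : Prop := p.1 < q.1 \/ p.1 = q.1 /\ p.2 < q.2.

Lemma lex_ind (P : nat * nat -> Prop) :
  (forall p, (forall q, lex q p -> P q) -> P p) -> forall p, P p.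
Proof.
move=> H; suff K a : forall a', a' < a -> forall b, P (a', b) by move=> [a b];
  apply: (K a.+1).
elim: a => // a IH a' lt b; move: {2}b.+1 (ltnSn b) => N; elim: N b => // N IHb b ltb.
apply: H => -[x y] [/= l|[/= -> l]]; first by apply: IH; apply: leq_trans l lt.
by apply: IHb; apply: leq_trans l ltb.
Qed.

Section Run.
Variables (n : nat) (A : object).

Notation I := (algorithmU n A).
Notation config := (config I).
Notation Idle := (@Idle n A I).
Notation Busy := (@Busy n A I).
Notation head := (@None 'I_n).
Notation announce := (@Some 'I_n).
Notation memory := (memory n A).

Implicit Types (m : memory) (i j k : 'I_n) (f : uframe n A) (c : config).

Variables (C : nat -> config) (lab : nat -> label n A).
Hypothesis C_inv : forall t, inv (C t).
Hypothesis C_step : forall t, transition (C t) (lab t, C t.+1).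

Notation M t := (mem (C t) : memory).
Notation act t := (actor (lab t)).
Notation pline k t := (proc_line (proc (C t) k)).

Lemma C_effect t : effect (act t) (M t) (M t.+1).
Proof. exact: (transition_effect (C_inv t) (C_step t)). Qed.

Lemma C_others t k : k <> act t -> proc (C t.+1) k = proc (C t) k.
Proof. by move=> ne; have := transition_others (C_step t) ne. Qed.

Definition prio (s : proc_state I) : 'I_n :=
  match s with Defs.Idle x => x | Defs.Busy _ f => priority f end.

Notation pr k t := (prio (proc (C t) k)).

Variant self_step t k : Prop :=
| SelfQuiet of M t.+1 = M t & quiet (M t) k
    & (if pline k t.+1 is Some l then calm l else true) & pr k t.+1 = pr k t
| SelfStuck of M t.+1 = M t & pline k t.+1 = pline k t & pr k t.+1 = pr k t
| SelfMoves o l pl of line_inv (M t) k o l & pline k t = Some l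
    & pline k t.+1 = Some pl.2 & moves k (pr k t) (M t) l (M t.+1) pl & pr k t.+1 =
      pl.1.

Lemma C_self t : self_step t (act t).
Proof.
have H := C_inv t; have := C_step t; move ex : (lab t, C t.+1) => x T.
have -> : lab t = x.1 by rewrite -ex.
have e2 : C t.+1 = x.2 by rewrite -ex.
case: T e2 {ex} => [i o s w e|i o f r e e'|i o f f' w e st wf|i o f w m' pl e mv] /= e2.
- apply: SelfQuiet; rewrite ?e2 /= ?/set_proc ?eqxx ?e //=.
    by have := H i; rewrite e => -[].
  by case: asboolP.
- apply: SelfQuiet; rewrite ?e2 /= ?/set_proc ?eqxx ?e //=.
  by have := H i; rewrite e => -[_ [_]]; rewrite e'.
- by apply: SelfStuck; rewrite ?e2 /= ?/set_proc ?eqxx ?e //=;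
    case: (stuck_line st) => _ p1 p2; rewrite ?p1 ?p2.
- have := H i; rewrite e => -[_ [_ L]].
  apply: (SelfMoves (pl := pl) L); rewrite ?e2 /= ?/set_proc ?eqxx ?e //; exact: mv.
Qed.

Definition val b t := (M t b).1.

Lemma bit_stable (pot : nat -> nat) (bit : nat -> bool) T :
  (forall t, T <= t -> pot t.+1 <= pot t /\ (pot t.+1 = pot t -> bit t.+1 = bit t)) ->
  exists2 T', T <= T' & forall t, T' <= t -> bit t = bit T'.
Proof.
move=> H; have [T' le st] := eventually_stable (fun t le => (H t le).1).
exists T' => // t; elim: t => [|t IH]; first by rewrite leqn0 => /eqP ->.
rewrite leq_eqVlt => /orP[/eqP <- //|]; rewrite ltnS => le'; rewrite -IH //.
apply: (H t (leq_trans le le')).2; by rewrite !st // ltnW.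
Qed.

Definition val_const b T : Prop := forall t, T <= t -> val b t.+1 = val b t.

Lemma stableE (X : Type) (f : nat -> X) T : (forall t, T <= t -> f t.+1 = f t) ->
  forall t, T <= t -> f t = f T.
Proof.
move=> H; elim=> [|t IH]; first by rewrite leqn0 => /eqP ->.
rewrite leq_eqVlt => /orP[/eqP <- //|]; rewrite ltnS => le; by rewrite -IH // H.
Qed.

Lemma bits_stable b T : val_const b T ->
  (forall k, exists2 T', T <= T' & forall t, T' <= t -> (M t b).2 k = (M T' b).2 k) ->
  exists2 T', T <= T' & forall t, T' <= t -> M t b = M T' b.
Proof.
move=> vc H.
have [T' le st] : exists2 T', T <= T' & forall t, T' <= t -> forall k, (M t.+1 b).2 k =
  (M t b).2 k.
  apply: (eventually_forall (P := fun k t => (M t.+1 b).2 k = (M t b).2 k)) => k.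
  by case: (H k) => T' le st; exists T' => // t le'; rewrite !st // ltnW.
exists T' => //; apply: (stableE (f := fun t => M t b)) => t le'.
rewrite (surjective_pairing (M t.+1 b)) (surjective_pairing (M t b)); congr (_, _).
  exact: vc (leq_trans le le').
by apply/ffunP => k; apply: st.
Qed.

Lemma head_stable T : val_const head T ->
  exists2 T', T <= T' & forall t, T' <= t -> M t head = M T' head.
Proof.
move=> vc; apply: bits_stable => // k.
apply: (bit_stable (bit := fun t => hb (M t) k) (pot := fun t => head_pot (M t) k
  (pline k t))) => t le.
have e := vc t le; case: (eqVneq k (act t)) => [ek|/eqP ne].
  have := C_self t; rewrite -ek; case=> [e1 q cl _|-> -> //|o l pl L e1 e2 mv _].
    rewrite e1; split=> //; case: q => [q1 /negbTE q2 q3].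
    by rewrite /head_pot /owes q1 q2 q3.
  by rewrite e1 e2; apply: moves_head_pot mv L e.
have eb := effect_hb (C_effect t) ne e.
split=> //; rewrite /head_pot C_others // eb leq_add2r leq_mul2r /=.
have := effect_owes (k := k) (C_effect t) e; by case: (owes _ k) => // ->.
Qed.

(** [head] passes from one response to another only through bottom. *)
Lemma val_const_head_for j T : (forall t, T <= t -> head_for (M t) j) -> val_const head
  T.
Proof.
move=> H t le; have := H _ (leqW le); have := H _ le.
rewrite /val /head_for;
  case: (C_effect t) => [|b x|k o q e _|q r k e _|q r k o _ _|o _ _|_ _] //=;
  rewrite -/(hd _) ?memE //=; by rewrite ?val_link // e.
Qed.

Lemma head_for_lost t j : head_for (M t) j -> ~~ head_for (M t.+1) j ->
  is_rsp (an (M t.+1) j).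
Proof.
rewrite /head_for; case: (C_effect t) => [|b x|k o q e _|q r k e e1|q r k o _ _|o _ _|
  _ _];
  rewrite ?memE ?e //= => h; rewrite ?h //.
by move/eqP: h => <-.
Qed.

Lemma head_for_kept_off t j : is_rsp (an (M t) j) -> ~~ head_for (M t) j ->
  ~~ head_for (M t.+1) j.
Proof.
rewrite /head_for; case: (C_effect t) => [|b x|k o q e e1|q r k e e1|q r k o _ _|o _ _|
  _ _];
  rewrite ?memE //= => h _.
by apply/eqP => ej; rewrite -ej e1 in h.
Qed.

Lemma ann_stable j T : val_const (announce j) T ->
  exists2 T', T <= T' & forall t, T' <= t -> M t (announce j) = M T' (announce j).
Proof.
move=> vc.
have ea t : T <= t -> an (M t.+1) j = an (M t) j by exact: vc.
(* Either [head] is eventually never for [j], and [visit_pot] applies, or it is so at arbitrarily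
   late times. *)
have [[T1 le1 nf]|N] := pselect (exists2 T1, T <= T1 & forall t, T1 <= t -> ~~ head_for
  (M t) j).
  suff [T' le' st] : exists2 T', T1 <= T' & forall t, T' <= t -> M t (announce j) = M
    T' (announce j).
    by exists T' => //; apply: leq_trans le'.
  apply: bits_stable => [t le|k]; first exact: vc (leq_trans le1 le).
  apply: (bit_stable (bit := fun t => ab (M t) j k) (pot := fun t => visit_pot (M t) k
    j (pline k t))) => t le.
  have e := ea t (leq_trans le1 le); case: (eqVneq k (act t)) => [ek|/eqP ne].
    have := C_self t; rewrite -ek; case=> [e1 q cl _|-> -> //|o l pl L e1 e2 mv _].
      rewrite e1; split=> //; rewrite /visit_pot leq_add2r.
      by case: (pline k t.+1) cl => // -[].
    by rewrite e1 e2; apply: moves_visit_pot mv L e (nf t le).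
  by rewrite /visit_pot C_others // (effect_ab (C_effect t) ne e).
(* In the second case it is for [j] for ever: if it were lost, [j] would be answered, and with
   [announce[j]] constant nothing could be applied for [j] again. *)
have [T1 le1 hf] : exists2 T1, T <= T1 & forall t, T1 <= t -> head_for (M t) j.
  have [t1 le1 h1] : exists2 t, T <= t & head_for (M t) j.
    apply: contrapT => N1; apply: N; exists T => // t le; apply/negP => h.
    by apply: N1; exists t.
  exists t1 => //; elim=> [|t IH]; first by rewrite leqn0 => /eqP <-.
  rewrite leq_eqVlt => /orP[/eqP <- //|]; rewrite ltnS => le; have h := IH le.
  apply/negPn/negP => h'; apply: N; exists t.+1; first exact: leqW (leq_trans le1 le).
  have r := head_for_lost h h'.
  suff H u : t.+1 <= u -> is_rsp (an (M u) j) && ~~ head_for (M u) j by move=> u /H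
    /andP[].
  elim: u => [//|u IHu]; rewrite leq_eqVlt => /orP[/eqP <-|]; first by rewrite r h'.
  rewrite ltnS => le2; case/andP: (IHu le2) => r2 h2.
  rewrite (head_for_kept_off r2 h2) ea ?r2 //.
  exact: leq_trans (leq_trans le1 le) (ltnW le2).
have vh := val_const_head_for hf.
suff [T' le' st] : exists2 T', T1 <= T' & forall t, T' <= t -> M t (announce j) = M T'
  (announce j).
  by exists T' => //; apply: leq_trans le'.
apply: bits_stable => [t le|k]; first exact: vc (leq_trans le1 le).
apply: (bit_stable (bit := fun t => ab (M t) j k) (pot := fun t => serve_pot (M t) k j
  (pline k t))) => t le.
have e := ea t (leq_trans le1 le); have eh := vh t le;
  have eo := effect_owes (k := k) (C_effect t) eh.
case: (eqVneq k (act t)) => [ek|/eqP ne].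
  have := C_self t; rewrite -ek;
    case=> [e1 [q1 /negbTE q2 _] cl _|-> -> //|o l pl L e1 e2 mv _].
    rewrite e1; split=> //; rewrite /serve_pot /owes q1 q2 leq_add2r.
    by case: (pline k t.+1) cl => // -[].
  rewrite e1 e2; apply: moves_serve_pot mv L e eh (hf t le) _.
  exact: head_for_unanswered (hf t le).
rewrite /serve_pot C_others // (effect_ab (C_effect t) ne e); split=> //.
by rewrite !leq_add2r leq_mul2r /=; case: (owes _ k) eo => // ->.
Qed.

(** * Completion of single instructions *)

Definition object_of (c : instr n A) : option (option 'I_n) :=
  match c with @Call _ _ b _ _ => Some b | @Par _ _ b _ _ _ => Some b | Ret _ => None
    end.

Definition is_call (c : instr n A) : bool :=
  if c is @Call _ _ _ op _ then (if op is LL then false else true) else false.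

Definition waits (c : instr n A) m : Prop :=
  if c is @Par _ _ _ _ b' wait then wait (m b').1 <> None else False.

(** Steps before a CAS that must succeed: none with the right saved value, the Read without one, and
    a failing CAS plus the Read with a stale one. *)
Definition tries (V : Type) (x : V) (s : option V) : nat :=
  if s is Some cur then (if `[< cur = x >] then 0 else 2) else 1.

(** Once the object has the value [X] for ever, an LL, SC or RL needs two
    more steps of its own at most, plus those of the waiting side. *)
Definition call_rank (X : memory) (c : instr n A) : substate c -> nat * nat :=
  match c with
  | @Call _ _ b _ _ => fun s => (tries (X b) s, 0)
  | @Par _ _ b _ _ _ => fun su => (tries (X b) su.1, if su.2.1 then 0 else su.2.2.+1)
  | Ret _ => fun _ => (0, 0)
  end.

(** For an unlinked caller: after at most one failing CAS, the next Read finds the bit clear and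
    ends the call. *)
Definition read_rank (c : instr n A) : substate c -> nat * nat :=
  match c with
  | @Call _ _ b _ _ => fun s => (isSome s : nat, 0)
  | _ => fun _ => (0, 0)
  end.

(** Once the wait condition holds, only the rest of the current turn of the LL delays the Load that
    ends the instruction. *)
Definition wait_rank (c : instr n A) : substate c -> nat * nat :=
  match c with
  | @Par _ _ b _ _ _ => fun su => (0, if su.2.1 then su.2.2.+1 else 0)
  | _ => fun _ => (0, 0)
  end.

Lemma retries_tries (V : Type) i (op : llsc_op V) x s s' :
  retries i op x s s' -> tries x s' < tries x s.
Proof.
rewrite /retries /tries => -[_ [[-> ->]|[cur [-> ne] ->]]]; first by case: asboolP.
by case: asboolP.
Qed.

Lemma call_rank_lt X (c : instr n A) i m w (s s' : substate c) :
  (forall b, object_of c = Some b -> m b = X b) -> stays i m w s s' ->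
  lex (call_rank X s') (call_rank X s).
Proof.
case: c s s' => [b op k|b k b' wait|r] //= s s' H.
  by rewrite (H b) // => /retries_tries; left.
case: s => s [side k'] /=; case: s' => s' u' /= [-> +]; rewrite (H b) //.
by case: side => [/retries_tries|[-> _]]; [left | right; case: k'].
Qed.

Lemma read_rank_lt (c : instr n A) i m w (s s' : substate c) b :
  is_call c -> object_of c = Some b -> (m b).2 i = false -> stays i m w s s' ->
  lex (read_rank s') (read_rank s).
Proof.
case: c s s' => [b0 op k|b0 k b' wait|r] //= s s' ic [eb] e; subst b.
have step : (s = None -> (m b0).2 i) -> s = None /\ s' = Some (m b0) \/
    (exists2 cur, s = Some cur /\ cur <> m b0 & s' = None) ->
    lex (isSome s' : nat, 0) (isSome s : nat, 0).
  by rewrite e => H [[es _]|[cur [-> _] ->]]; [move: (H es) | left].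
by rewrite /retries; case: op k ic => [||v|||v] k //= _ [] //.
Qed.

Lemma wait_rank_lt (c : instr n A) i m w (s s' : substate c) :
  waits c m -> stays i m w s s' -> lex (wait_rank s') (wait_rank s).
Proof.
case: c s s' => [b op k|b k b' wait|r] //= [s [side k']] [s' u'] /= W [-> +].
by case: side => [_|[_ //]]; right; case: k'.
Qed.

(** * Contradiction from an operation that never returns *)

Section Process.
Variables (i : 'I_n) (o : operation A) (t0 : nat) (fr : nat -> uframe n A).
Hypothesis busy : forall t, t0 <= t -> proc (C t) i = Busy o (fr t).
Hypothesis active_i : forall t, exists2 t', t <= t' & act t' = i.

Definition moved t : Prop :=
  act t = i /\ exists w pl, fr t.+1 = enter i pl w /\
    moves i (priority (fr t)) (M t) (at_line (fr t)) (M t.+1) pl.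

Lemma busy_inj o1 f1 o2 f2 : Busy o1 f1 = Busy o2 f2 -> f1 = f2.
Proof. by case. Qed.

Lemma fr_other t : t0 <= t -> act t <> i -> fr t.+1 = fr t.
Proof.
move=> le ne; have e := C_others (k := i) (fun e => ne (esym e)).
by move: e; rewrite !busy // ?leqW // => /busy_inj.
Qed.

Lemma fr_own t : t0 <= t -> act t = i ->
  (M t.+1 = M t /\ exists w, stuck i (M t) w (fr t) (fr t.+1)) \/ moved t.
Proof.
move=> le ea; have e1 := busy le; have e2 := busy (leqW le).
have := C_step t; rewrite /moved ea; move ex : (lab t, C t.+1) => x T.
have ea' : actor x.1 = i by rewrite -ex.
have ex' : C t.+1 = x.2 by rewrite -ex.
case: T ea' ex' {ex} => [i' o' s w e|i' o' f r e e'|i' o' f f' w e st wf|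
  i' o' f w m' pl e mv] /= ei ex; subst i';
  rewrite ex /= /set_proc eqxx in e2; move: e; rewrite e1 // => -[eo ef];
    move: e2 => [_ ef'].
- by left; rewrite ex; split=> //; exists w; rewrite ef -ef'.
- by right; split=> //; exists w, pl; rewrite ef ex.
Qed.

Lemma next_own t : t0 <= t -> exists2 t', t <= t' & act t' = i /\ fr t' = fr t.
Proof.
move=> le; have [t1 le1 e1] := active_i t.
move: {2}(t1 - t) (erefl (t1 - t)) => d; elim: d t le le1 => [|d IH] t le le1 ed.
  exists t => //; split=> //; suff -> : t = t1 by [].
  by apply/eqP; rewrite eqn_leq le1 -subn_eq0 ed.
case: (eqVneq (act t) i) => [e|/eqP ne]; first by exists t.
have lt : t < t1 by rewrite -subn_gt0 ed.
case: (IH t.+1 (leqW le) lt) => [|t' le' [e2 e3]]; first by rewrite subnS ed.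
exists t'; first exact: ltnW.
by split=> //; rewrite e3 fr_other.
Qed.

Definition same_point T t : Prop :=
  at_line (fr t) = at_line (fr T) /\ priority (fr t) = priority (fr T).

Lemma eventually_moves (mu : uframe n A -> nat * nat) T : t0 <= T ->
  (forall t w f f', T <= t -> at_line f = at_line (fr T) -> priority f = priority (fr
    T) ->
     stuck i (M t) w f f' -> lex (mu f') (mu f)) ->
  exists2 t, T <= t & same_point T t /\ moved t.
Proof.
move=> le0 H.
suff K p : forall t, T <= t -> same_point T t -> mu (fr t) = p ->
    exists2 t', t <= t' & same_point T t' /\ moved t'.
  exact: K (leqnn T) _ erefl.
move: p; apply: lex_ind => p IH t le sp ep.
have [t1 le1 [ea ef]] := next_own (leq_trans le0 le).
have le2 := leq_trans le le1.
case: (fr_own (leq_trans le0 le2) ea) => [[em [w st]]|mv]; last first.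
  by exists t1 => //; rewrite /same_point ef.
rewrite ef in st; case: (sp) => s1 s2; have lt := H _ _ _ _ le2 s1 s2 st.
rewrite ep in lt; case: (stuck_line st) => _ p1 p2.
have sp' : same_point T t1.+1 by rewrite /same_point p1 p2.
case: (IH _ lt t1.+1 (leqW le2) sp' erefl) => t' le' Ht'.
by exists t' => //; apply: leq_trans le'; apply: leqW.
Qed.

Notation pcode t := (code i (priority (fr t)) (at_line (fr t))).

Lemma never_moved T : t0 <= T -> ~ (exists2 t, T <= t & same_point T t /\ moved t) ->
  forall t, T <= t -> same_point T t /\ (act t = i -> M t.+1 = M t).
Proof.
move=> le0 N.
have own t : T <= t -> same_point T t -> act t = i ->
    M t.+1 = M t /\ exists w, stuck i (M t) w (fr t) (fr t.+1).
  move=> le sp e; case: (fr_own (leq_trans le0 le) e) => // mv.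
  by case: N; exists t.
suff sp t : T <= t -> same_point T t.
  move=> t le; split; first exact: sp.
  by move=> e; case: (own t le (sp t le) e).
elim: t => [|t IH]; first by rewrite leqn0 => /eqP ->.
rewrite leq_eqVlt => /orP[/eqP <- //|]; rewrite ltnS => le; have [s1 s2] := IH le.
case: (eqVneq (act t) i) => [e|/eqP ne];
  last by rewrite /same_point fr_other // (leq_trans le0).
case: (own t le (IH le) e) => _ [w /stuck_line [_ p1 p2]].
by rewrite /same_point p1 p2.
Qed.

Lemma stable_moves T b : t0 <= T -> object_of (pcode T) = Some b ->
  (exists2 T', T <= T' & forall t, T' <= t -> M t b = M T' b) ->
  exists2 t, T <= t & same_point T t /\ moved t.
Proof.
move=> le0 eb [T' le' st]; apply: contrapT => N.
have [[s1 s2] _] := never_moved le0 N le'.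
apply: N; have [|t le [sp mv]] := @eventually_moves (fun f => call_rank (M T')
  (progress f)) T' (leq_trans le0 le').
  move=> t w f f' le e1 e2 S; case: S e1 e2 => pr l s s' S /= e1 e2.
  apply: call_rank_lt S => b'; rewrite e1 e2 s1 s2 eb => -[<-]; exact: st.
exists t; first exact: leq_trans le.
by split=> //; case: sp; rewrite /same_point s1 s2.
Qed.

Lemma effect_bit k m m' b : effect k m m' -> k <> i -> (m' b).2 i ->
  (m b).2 i /\ (m' b).1 = (m b).1.
Proof.
by move=> E ne; case: b => [j|]; [exact: (frame_ab E ne) | exact: (frame_hb E ne)].
Qed.

Lemma val_stable b T : val_const b T ->
  exists2 T', T <= T' & forall t, T' <= t -> M t b = M T' b.
Proof. by case: b => [j|]; [exact: ann_stable | exact: head_stable]. Qed.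

(** A process that retries an SC or an RL for ever stays linked to the object,
    whose value is then constant. *)
Lemma call_moves T : t0 <= T -> is_call (pcode T) ->
  exists2 t, T <= t & same_point T t /\ moved t.
Proof.
move=> le0 ic; apply: contrapT => N; have H := never_moved le0 N.
have [b eb] : exists b, object_of (pcode T) = Some b.
  by case: (pcode T) ic => // b *; exists b.
have unlinked t : T <= t -> (M t b).2 i = false -> (M t.+1 b).2 i = false.
  move=> le; case: (eqVneq (act t) i) => [e|/eqP ne]; first by rewrite (H t le).2.
  by move=> e; apply/negP => /(effect_bit (C_effect t) ne) []; rewrite e.
(* If the link were ever missing it would stay so, as only an LL by [i] restores it, and [read_rank]
   would end the call. *)
have linked t : T <= t -> (M t b).2 i.
  move=> le; apply/negPn/negP => /negbTE e; apply: N; have [[s1 s2] _] := H t le.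
  have off u : t <= u -> (M u b).2 i = false.
    elim: u => [|u IH]; first by rewrite leqn0 => /eqP <-.
    rewrite leq_eqVlt => /orP[/eqP <- //|]; rewrite ltnS => le'.
    exact: unlinked (leq_trans le le') (IH le').
  have [|u le' [sp mv]] := @eventually_moves (fun f => read_rank (progress f)) t
    (leq_trans le0 le).
    move=> u w f f' le' e1 e2 S; case: S e1 e2 => pr l s s' S /= e1 e2.
    by apply: (read_rank_lt _ _ (off u le') S); rewrite e1 e2 s1 s2.
  exists u; first exact: leq_trans le'.
  by split=> //; case: sp; rewrite /same_point s1 s2.
apply: N; apply: (stable_moves le0 eb); apply: val_stable => t le.
case: (eqVneq (act t) i) => [e|/eqP ne]; first by rewrite /val (H t le).2.
exact: (effect_bit (C_effect t) ne (linked _ (leqW le))).2.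
Qed.

Lemma wait_moves T T' : t0 <= T -> T <= T' ->
  (forall t, T' <= t -> waits (pcode T) (M t)) ->
  exists2 t, T <= t & same_point T t /\ moved t.
Proof.
move=> le0 le' W; apply: contrapT => N.
have [[s1 s2] _] := never_moved le0 N le'.
apply: N; have [|t le [sp mv]] := @eventually_moves (fun f => wait_rank (progress f))
  T' (leq_trans le0 le').
  move=> t w f f' le e1 e2 S; case: S e1 e2 => pr l s s' S /= e1 e2.
  by apply: wait_rank_lt S; rewrite e1 e2 s1 s2; apply: W.
exists t; first exact: leq_trans le.
by split=> //; case: sp; rewrite /same_point s1 s2.
Qed.

Lemma fr_line t : t0 <= t -> line_inv (M t) i o (at_line (fr t)).
Proof. by move=> le; have := C_inv t i; rewrite busy // => -[_ []]. Qed.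

Lemma not_returning t r : t0 <= t -> at_line (fr t) <> U17 n r.
Proof.
move=> le el; have [t' le' [ea ef]] := next_own le.
rewrite -ef in el; case: (fr_own (leq_trans le le') ea) => [[_ [w]]|[_ [w [pl [_]]]]].
  move=> st; case: st el => p l s s' S /= el; move: s s' S; rewrite el; by [].
by rewrite el => mv; inversion mv.
Qed.

Lemma moved_line t : moved t -> exists2 pl, at_line (fr t.+1) = pl.2 &
  moves i (priority (fr t)) (M t) (at_line (fr t)) (M t.+1) pl.
Proof. by case=> _ [w [pl [-> mv]]]; exists pl. Qed.

Lemma answered_kept t : t0 <= t -> is_rsp (an (M t) i) -> is_rsp (an (M t.+1) i).
Proof.
move=> le r; case: (eqVneq (act t) i) => [e|/eqP ne];
  last exact: (frame_is_rsp (C_effect t) ne).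
case: (fr_own le e) => [[-> _ //]|/moved_line [pl el mv]].
have nr r' : pl.2 <> U17 n r' by rewrite -el; apply: not_returning; apply: leqW.
by case: (moves_answered mv (fr_line le) r nr).
Qed.

Lemma answered_returns T : t0 <= T -> is_rsp (an (M T) i) -> False.
Proof.
move=> le0 r0.
have rsp t : T <= t -> is_rsp (an (M t) i).
  elim: t => [|t IH]; first by rewrite leqn0 => /eqP <-.
  rewrite leq_eqVlt => /orP[/eqP <- //|]; rewrite ltnS => le.
  by apply: answered_kept (IH le); apply: leq_trans le.
suff K N : forall t, T <= t -> answered_rank (at_line (fr t)) < N -> False.
  exact: (K _ _ (leqnn T) (ltnSn _)).
elim: N => // N IH t le lt.
have le1 := leq_trans le0 le.
suff [t1 le2 [[sp _] mv]] : exists2 t1, t <= t1 & same_point t t1 /\ moved t1.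
  have [pl el mv'] := moved_line mv; have le3 := leq_trans le1 le2.
  have nr r' : pl.2 <> U17 n r' by rewrite -el; apply: not_returning; apply: leqW.
  apply: (IH t1.+1); first exact: leqW (leq_trans le le2).
  have [_ lt'] := moves_answered mv' (fr_line le3) (rsp _ (leq_trans le le2)) nr.
  by rewrite el; apply: leq_trans lt' _; rewrite sp.
have an_wait u : t <= u -> forall X (x : X),
    match (M u (announce i)).1 with Rsp _ => Some x | _ => None end <> None.
  by move=> leu X x; have := rsp u (leq_trans le leu); rewrite /an;
    case: (M u (announce i)).1.
have nr := @not_returning t;
  case el : (at_line (fr t)) nr => [op|op|op|op|op q|op q|op sr j|op q rsp' j|j|
  op q rsp' j a|op q rsp' j a|op q j a|op j||r|r q|r|r|r] nr.
all: try by apply: call_moves => //; rewrite el.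
- by apply: (wait_moves le1 (leqnn t)) => u leu; rewrite el /=; apply: an_wait.
- by apply: (wait_moves le1 (leqnn t)) => u leu; rewrite el /=; apply: an_wait.
- have [[T1 le2 off]|N1] := pselect (exists2 T1, t <= T1 & ~~ head_for (M T1) i).
    apply: (wait_moves le1 le2) => u leu; rewrite el /=.
    suff : ~~ head_for (M u) i by rewrite /head_for /hd; case: is_for.
    elim: u leu => [|u IHu]; first by rewrite leqn0 => /eqP <-.
    rewrite leq_eqVlt => /orP[/eqP <- //|]; rewrite ltnS => leu.
    by apply: head_for_kept_off (IHu leu); apply: rsp;
      apply: leq_trans (leq_trans le le2) leu.
  apply: (@stable_moves t head) => //; first by rewrite el.
  apply: head_stable; apply: (@val_const_head_for i) => u leu.
  by apply/negPn/negP => off; apply: N1; exists u.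
- by case: (nr r le1).
Qed.

Lemma unanswered t : t0 <= t -> ~~ is_rsp (an (M t) i).
Proof. by move=> le; apply/negP => /(answered_returns le). Qed.

Lemma announced : exists2 t1, t0 <= t1 & forall t, t1 <= t -> an (M t) i = Op o.
Proof.
have [t1 le1 e1] : exists2 t1, t0 <= t1 & an (M t1) i = Op o.
  have L := fr_line (leqnn t0); case: (line_status L) => [[q cl]|[[_ _ [e|r]] _]];
    last first.
  - by case: (answered_returns (leqnn t0) r).
  - by exists t0.
  have nr := @not_returning t0.
  case el: (at_line (fr t0)) cl nr L => [op|
    op| | | | | | | | | | | | | | | | |r] //= _ nr L.
  - have [|t le [[e _] /moved_line [pl e1 mv]]] := @call_moves t0 (leqnn t0);
      first by rewrite el.
    move: mv; rewrite e el => mv; inversion mv; subst.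
    by case: (@not_returning t.+1 _ (leqW le) e1).
  - have [|t le [[e _] /moved_line [pl e1 mv]]] := @call_moves t0 (leqnn t0);
      first by rewrite el.
    exists t.+1; first exact: leqW.
    have := fr_line (leqW le); move: mv; rewrite e el => mv; inversion mv; subst.
    rewrite e1 /= => -[_ _ [//|r]]; rewrite H in r;
      by case: (answered_returns (leqW le) r).
  - by case: (nr r).
exists t1 => // t; elim: t => [|t IH]; first by rewrite leqn0 => /eqP <-.
rewrite leq_eqVlt => /orP[/eqP <- //|]; rewrite ltnS => le; have e := IH le.
have := unanswered (leq_trans le1 (leqW le)).
case: (C_effect t) => [|b x|j o' q _ _|q r j _ _|q r j o' _ _|o' e2 _|e2 _];
  rewrite ?memE //.
- by case: eqP.
- by case: eqP => // ei; rewrite ei in e; rewrite e in e2.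
- by case: eqP => // ei; rewrite ei in e; rewrite e in e2.
Qed.

Lemma ann_val_const j T : val_const head T ->
  exists2 T', T <= T' & val_const (announce j) T'.
Proof.
move=> vc; have H t : T <= t -> ann_rank (M t.+1) j <= ann_rank (M t) j /\
    (ann_rank (M t.+1) j = ann_rank (M t) j -> an (M t.+1) j = an (M t) j).
  by move=> le; exact: effect_ann_rank (C_effect t) (vc t le).
have [T' le st] := eventually_stable (fun t le => (H t le).1).
exists T' => // t le'; apply: (H t (leq_trans le le')).2.
by rewrite !st // leqW.
Qed.

(** A constant value would make all of [head], including the link of [i], constant from some time
    on; each completed instruction of [i] would then lower [pending_rank]. *)
Lemma head_changes T : ~ val_const head T.
Proof.
move=> vc; have [t1 le1 ao] := announced.
have [|T2 le2 st] := @head_stable (maxn T t1).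
  by move=> t; rewrite geq_max => /andP[le _]; apply: vc.
move: le2; rewrite geq_max => /andP[le2 le3]; have le4 := leq_trans le1 le3.
pose b := hb (M T2) i.
have hbE t : T2 <= t -> hb (M t) i = b by move=> le; rewrite /b /hb st.
suff K N : forall t, T2 <= t -> pending_rank b (at_line (fr t)) < N -> False.
  exact: (K _ _ (leqnn T2) (ltnSn _)).
elim: N => // N IH t le lt; have le5 := leq_trans le4 le.
suff [t' le6 [[sp _] mv]] : exists2 t', t <= t' & same_point t t' /\ moved t'.
  have [pl el mv'] := moved_line mv; have le7 := leq_trans le le6.
  apply: (IH t'.+1); first exact: leqW le7.
  have := moves_pending mv' (fr_line (leq_trans le4 le7)) (ao _ (leq_trans le3 le7))
    (hbE _ le7) (hbE _ (leqW le7)).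
  by rewrite el => lt'; apply: leq_trans lt' _; rewrite sp.
have L := fr_line le5; have nr := @not_returning t.
have na := unanswered le5.
case el : (at_line (fr t)) L nr => [op|op|op|op|op q|op q|op sr j|op q rsp' j|j|
  op q rsp' j a|op q rsp' j a|op q j a|op j||r|r q|r|r|r] L nr.
all: try by apply: call_moves => //; rewrite el.
- apply: (@stable_moves t head) => //; first by rewrite el.
  by exists t => // u leu; rewrite (st u (leq_trans le leu)) (st t le).
- apply: (@stable_moves t (announce j)) => //; first by rewrite el.
  have [|T3 le6 vj] := @ann_val_const j t; first by move=> u leu; apply: vc;
    exact: leq_trans (leq_trans le2 le) leu.
  by have [T4 le7 st4] := ann_stable vj; exists T4 => //; exact: leq_trans le7.
- by case: L => _ e; rewrite e in na.
- by case: (nr r le5).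
Qed.

(** A response for [i] leaves [head] only after [i] is answered, so it would stay for ever and make
    [head] constant. *)
Lemma never_served : exists2 t1, t0 <= t1 & forall t, t1 <= t ->
  an (M t) i = Op o /\ ~~ head_for (M t) i.
Proof.
have [t1 le1 ao] := announced; exists t1 => // t le; split; first exact: ao.
apply/negP => h; apply: (@head_changes t); apply: (@val_const_head_for i).
elim=> [|u IH]; first by rewrite leqn0 => /eqP <-.
rewrite leq_eqVlt => /orP[/eqP <- //|]; rewrite ltnS => leu.
apply/negPn/negP => /(head_for_lost (IH leu)).
by apply/negP; apply: unanswered; apply: leqW; apply: leq_trans leu;
  apply: leq_trans le.
Qed.

Definition applies k t : Prop := [/\ act t = k, ~~ (hd (M t)).2 & (hd (M t.+1)).2].

Definition good k t : Prop := if pline k t is Some l then favors i (pr k t) l else True.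

Lemma calm_good k t : (if pline k t is Some l then calm l else true) -> good k t.
Proof. by rewrite /good; case: (pline k t) => // -[]. Qed.

Lemma apply_good k t : applies k t -> good k t.+1.
Proof.
case=> ea h h'; have := C_self t; rewrite ea.
case=> [e|e|o' l pl L e1 e2 mv e3]; rewrite ?e in h'; rewrite ?(negbTE h) // in h' *.
by rewrite /good e2; case: (moves_apply mv h h') => op ->.
Qed.

Lemma good_step k t : an (M t) i = Op o -> ~~ head_for (M t.+1) i -> good k t ->
  [/\ good k t.+1, distance (pr k t.+1) i <= distance (pr k t) i
    & applies k t -> distance (pr k t.+1) i < distance (pr k t) i].
Proof.
move=> e h g; case: (eqVneq k (act t)) => [ek|/eqP ne]; last first.
  rewrite /good C_others //; split=> // -[ek]; by rewrite ek in ne.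
have nap : M t.+1 = M t -> ~ applies k t.
  by move=> em [_ h1]; rewrite em (negbTE h1).
have := C_self t; rewrite -ek; case=> [e1 q cl ->|e1 el ep|o' l pl L e1 e2 mv e3].
- by split=> //; [exact: calm_good | move=> /(nap e1)].
- by split; rewrite /good ?el ?ep // => /(nap e1).
rewrite /good e1 in g; have [g' D] := moves_favors mv L e h g.
rewrite /good e2 e3; split=> //.
  by case: D => [[-> _] //|[-> ne]]; apply: ltnW; apply: distance_ordS.
case=> _ h1 h2; case: D => [[_ /(_ h1)]|[-> ne]]; first by rewrite h2.
exact: distance_ordS.
Qed.

Lemma finitely_many_applies k T : t0 <= T ->
  exists2 T', T <= T' & forall t, T' <= t -> ~ applies k t.
Proof.
move=> le0; have [t1 le1 H] := never_served.
have [[t2 le2 ap]|N] := pselect (exists2 t, maxn T t1 <= t & applies k t); last first.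
  exists (maxn T t1); first exact: leq_maxl.
  by move=> t le ap; apply: N; exists t.
move: le2; rewrite geq_max => /andP[leT le2].
have stp t : t1 <= t -> good k t -> _ := fun le => good_step (k := k) (H t le).1 (H _
  (leqW le)).2.
(* [good] is claimed only after one application past [t1]: until then [k] may hold an operation
   selected before that of [i] was announced. *)
have g t : t2 < t -> good k t.
  elim: t => // t IH; rewrite ltnS leq_eqVlt => /orP[/eqP <-|lt];
    first exact: apply_good.
  by case: (stp t (leq_trans le2 (ltnW lt)) (IH lt)).
have G t : t2 < t -> _ := fun lt => stp t (leq_trans le2 (ltnW lt)) (g t lt).
have mono t : t2 < t -> distance (pr k t.+1) i <= distance (pr k t) i by move=> /G [].
have [T' le' st] := eventually_stable mono.
exists T'; first exact: leq_trans leT (leq_trans (leqnSn _) le').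
move=> t le ap'; have [_ _ /(_ ap')] := G t (leq_trans le' le).
by rewrite !st ?leqW // ltnn.
Qed.

Lemma process_returns : False.
Proof.
have [T le st] := eventually_forall (fun k => finitely_many_applies k (leqnn t0)).
(* Once all applications are over, the response in [head] can only be cleared, so the value of
   [head] is eventually constant. *)
have H t : T <= t -> isSome (hd (M t.+1)).2 <= isSome (hd (M t)).2.
  move=> le'; case e: (hd (M t)).2 => [x|]; first by case: (hd (M t.+1)).2.
  case e': (hd (M t.+1)).2 => [x|//]; case: (st t le' (act t)).
  by split=> //; rewrite ?e ?e'.
have [T' le' st'] := eventually_stable H.
apply: (@head_changes T') => t le2.
have := st' _ (leqW le2); rewrite -(st' t le2) /val -/(hd _) -/(hd _).
case: (C_effect t) => [|b x|j o' q e _|q r j e _|q r j o' _ _|o' _ _|_ _];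
  by rewrite ?memE ?e.
Qed.

End Process.

End Run.

(** * Wait-freedom *)

Section WaitFreedom.
Variables (n : nat) (A : object).

Notation I := (algorithmU n A).
Notation Busy := (@Busy n A I).

Lemma execution_prefix (tr : trace I) t t' x : execution tr -> t <= t' -> tr t' = Some
  x ->
  exists y, tr t = Some y.
Proof.
move=> E; elim: t' x => [|t' IH] x; first by rewrite leqn0 => /eqP -> ->; exists x.
rewrite leq_eqVlt => /orP[/eqP -> ->|]; first by exists x.
rewrite ltnS => le /E [c /= ec _]; case e: (tr t') ec => [y|//] _; exact: IH le e.
Qed.

Theorem algorithmU_wait_free : wait_free I.
Proof.
move=> tr t c i o f E ec e inf; apply: contrapT => N.
(* Process [i] acts infinitely often, so the execution is infinite and has a step at every date. *)
have tot u : exists x, tr u = Some x.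
  by have [u' [x [le eu _]]] := inf u; exact: execution_prefix E le eu.
pose lab u := if tr u is Some x then x.1 else Internal A i.
have stp u : transition (cfg tr u) (lab u, cfg tr u.+1).
  have [x ex] := tot u; have := cfg_transition E ex.
  by rewrite /lab /= ex; case: (x).
have busy u : t <= u -> exists f', proc (cfg tr u) i = Busy o f'.
  elim: u => [|u IH] le.
    by exists f; move: le; rewrite leqn0 => /eqP t0; rewrite -t0 (cfg_at ec).
  move: le; rewrite leq_eqVlt => /orP[/eqP eu|]; first by exists f;
    rewrite -eu (cfg_at ec).
  rewrite ltnS => le; have [f' ef] := IH le.
  have [x ex] := tot u; have T := cfg_transition E ex.
  rewrite /= ex; case: (eqVneq i (actor x.1)) => [ei|/eqP ne]; last first.
    by exists f'; rewrite (transition_others T ne).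
  case: T ex ei => [j o' y w e1|j o' f1 r e1 _|j o' f1 f2 w e1 _ _|
    j o' f1 w m' pl e1 _] /= ex ej;
    rewrite -ej in e1 ex *; move: e1; rewrite ef // => -[eo _].
  - by case: N; exists u, r; eexists; split; last exact: ex.
  - by rewrite /set_proc eqxx eo; exists f2.
  - by rewrite /set_proc eqxx eo; eexists.
pose fr u := if proc (cfg tr u) i is Defs.Busy _ f' then f' else f.
apply: (@process_returns n A (cfg tr) lab (fun u => inv_cfg u E) stp i o t fr).
  by move=> u le; have [f' ef] := busy u le; rewrite /fr ef.
move=> u; have [u' [x [le eu ea]]] := inf u; exists u' => //.
by rewrite /lab eu.
Qed.

End WaitFreedom.

Theorem theorem32 : forall (n : nat) (A : object),
  linearizable (algorithmU n A) /\
  wait_free (algorithmU n A) /\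
  state_quiescent_HI (algorithmU n A).
Proof.
move=> n A; split; first exact: algorithmU_linearizable.
by split; [exact: algorithmU_wait_free | exact: algorithmU_state_quiescent_HI].
Qed.
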